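(* Let $\Omega\subset\mathbb{R}^3$ be a bounded domain with $\partial\Omega\in C^{1,\alpha}$, $0<\alpha\le1$, and let $v\in C(\partial\Omega)$. Then the simple layer potential $$u(M)=\int_{\partial\Omega}\frac{v(P)}{r_{PM}}\,dS_P$$ satisfies, for every $P_0\in\partial\Omega$, $$\frac{\partial u(P_0)}{\partial n_{P_0}^{+}}=\int_{\partial\Omega}v(P)\,\frac{\partial \frac{1}{r_{PP_0}}}{\partial n_{P_0}}\,dS_P-2\pi v(P_0),\qquad \frac{\partial u(P_0)}{\partial n_{P_0}^{-}}=\int_{\partial\Omega}v(P)\,\frac{\partial \frac{1}{r_{PP_0}}}{\partial n_{P_0}}\,dS_P+2\pi v(P_0),$$ where $$\frac{\partial u(P_0)}{\partial n_{P_0}^{+}}=\lim_{M\to n_{P_0}^{+}}\frac{u(M)-u(P_0)}{r_{MP_0}},\qquad \frac{\partial u(P_0)}{\partial n_{P_0}^{-}}=\lim_{M\to n_{P_0}^{-}}\frac{u(P_0)-u(M)}{r_{P_0M}} .$$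
   Context: $r_{PM}=|P-M|$; $n_{P_0}$ is the exterior unit normal to $\partial\Omega$ at $P_0$. $M\to n_{P_0}^{+}$ (resp. $M\to n_{P_0}^{-}$) means that $M$ tends to $P_0$ along the normal line through $P_0$ in direction $n_{P_0}$ from the exterior (resp. interior) of $\Omega$. The kernel $\partial(1/r_{PP_0})/\partial n_{P_0}$ is the derivative of $M\mapsto 1/r_{PM}$ at $M=P_0$ in direction $n_{P_0}$, i.e. $-\cos(\mathbf r_{PP_0},n_{P_0})/r_{PP_0}^2$ with $\mathbf r_{PP_0}=\overrightarrow{PP_0}$. $\partial\Omega\in C^{1,\alpha}$ means: each point of $\partial\Omega$ has a neighbourhood in which $\partial\Omega$ is the graph of a $C^{1,\alpha}$ function of two of the three coordinates, with $\Omega$ locally on exactly one side of the graph. *)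

(* Defs.v *)
From HB Require Import structures.
From mathcomp Require Import all_boot all_order all_algebra.
From mathcomp Require Import all_classical all_reals all_analysis.
Set Implicit Arguments.
Unset Strict Implicit.
Unset Printing Implicit Defensive.
Import Order.TTheory GRing.Theory Num.Theory.
Import numFieldNormedType.Exports.
Local Open Scope classical_set_scope.
Local Open Scope ring_scope.

(* The library norm on R * R * R is the max norm (same topology), hence the
   separate Euclidean operations. *)
Definition dot3 (R : realType) (P Q : R * R * R) : R :=
  P.1.1 * Q.1.1 + P.1.2 * Q.1.2 + P.2 * Q.2.

Definition enorm3 (R : realType) (P : R * R * R) : R := Num.sqrt (dot3 P P).

Definition dist3 (R : realType) (P M : R * R * R) : R := enorm3 (P - M).

Definition boundary (T : topologicalType) (A : set T) : set T :=
  closure A `\` interior A.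

Definition bounded_domain (R : realType) (Omega : set (R * R * R)) : Prop :=
  [/\ Omega !=set0, open Omega, connected Omega & bounded_set Omega].

(* [put k x t] has k-th coordinate t and remaining coordinates x, in order;
   [coord k] and [drop_coord k] recover t and x. *)
Definition put (R : realType) (k : 'I_3) (x : R * R) (t : R) : R * R * R :=
  match val k with
  | 0 => (t, x.1, x.2)
  | 1 => (x.1, t, x.2)
  | _ => (x.1, x.2, t)
  end%N.

Definition coord (R : realType) (k : 'I_3) (P : R * R * R) : R :=
  match val k with 0 => P.1.1 | 1 => P.1.2 | _ => P.2 end%N.

Definition drop_coord (R : realType) (k : 'I_3) (P : R * R * R) : R * R :=
  match val k with
  | 0 => (P.1.2, P.2)
  | 1 => (P.1.1, P.2)
  | _ => (P.1.1, P.1.2)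
  end%N.

Definition partial1 (R : realType) (f : R * R -> R) (x : R * R) : R :=
  'D_((1, 0) : R * R) f x.

Definition partial2 (R : realType) (f : R * R -> R) (x : R * R) : R :=
  'D_((0, 1) : R * R) f x.

Definition holder_on (R : realType) (alpha : R) (V : set (R * R))
    (g : R * R -> R) : Prop :=
  exists C : R, forall x y : R * R, V x -> V y ->
    `|g x - g y| <= C * `|x - y| `^ alpha.

Definition C1_holder_on (R : realType) (alpha : R) (V : set (R * R))
    (f : R * R -> R) : Prop :=
  [/\ forall x : R * R, V x -> differentiable f x,
      holder_on alpha V (partial1 f) & holder_on alpha V (partial2 f)].

(* In the neighbourhood W, the boundary of Omega is the graph over V of f, as
   a function of the coordinates other than the k-th one, and Omega is exactly
   one of the two sides of that graph. *)
Definition graph_chart (R : realType) (alpha : R) (Omega : set (R * R * R))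
    (k : 'I_3) (V : set (R * R)) (W : set (R * R * R)) (f : R * R -> R) : Prop :=
  [/\ [/\ open V, open W & W `<=` drop_coord k @^-1` V],
      C1_holder_on alpha V f,
      boundary Omega `&` W = [set put k x (f x) | x in V] &
      Omega `&` W = [set P | W P /\ coord k P < f (drop_coord k P)] \/
      Omega `&` W = [set P | W P /\ f (drop_coord k P) < coord k P]].

Definition boundary_C1_holder (R : realType) (alpha : R)
    (Omega : set (R * R * R)) : Prop :=
  forall P : R * R * R, boundary Omega P ->
    exists k V W f, graph_chart alpha Omega k V W f /\ W P.

(* n is orthogonal to the two coordinate tangent vectors of the graph at P. *)
Definition exterior_unit_normal (R : realType) (alpha : R)
    (Omega : set (R * R * R)) (P n : R * R * R) : Prop :=
  (exists k V W f,
    [/\ graph_chart alpha Omega k V W f, W P,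
        dot3 n (put k (1, 0) (partial1 f (drop_coord k P))) = 0 &
        dot3 n (put k (0, 1) (partial2 f (drop_coord k P))) = 0]) /\
  enorm3 n = 1 /\
  \forall t \near 0^'+, ~ Omega (P + t *: n).

(* The area measure dS on the boundary, as a Borel measure on R^3: on every
   graph patch it has the area element sqrt(1 + |grad f|^2) dx. When countably
   many patches cover the boundary, these conditions determine sigma; they are
   consistent on overlaps by the change of variables formula. *)
Definition surface_measure (R : realType) (alpha : R) (Omega : set (R * R * R))
    (sigma : {measure set (measurableTypeR R * measurableTypeR R *
                           measurableTypeR R) -> \bar R}) : Prop :=
  (sigma (~` boundary Omega) = 0)%E /\
  forall k V W f, graph_chart alpha Omega k V W f ->
  forall A : set (measurableTypeR R * measurableTypeR R * measurableTypeR R),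
    measurable A -> A `<=` boundary Omega `&` W ->
    sigma A =
    (\int[lebesgue_measure \x lebesgue_measure]_(x in
        [set x | V x /\ A (put k x (f x))])
      (Num.sqrt (1 + partial1 f x ^+ 2 + partial2 f x ^+ 2))%:E)%E.

(* Here and in normal_kernel the value at P = M (resp. P = P0) is a junk value;
   singletons are null for the surface measure. *)
Definition simple_layer (R : realType) (Omega : set (R * R * R))
    (sigma : {measure set (measurableTypeR R * measurableTypeR R *
                           measurableTypeR R) -> \bar R})
    (v : R * R * R -> R) (M : R * R * R) : R :=
  \int[sigma]_(P in boundary Omega) (v P / dist3 P M).

Definition normal_kernel (R : realType) (P P0 n : R * R * R) : R :=
  'D_n (fun M : R * R * R => (dist3 P M)^-1) P0.

(* Main.v *)
Require Import Defs.
From mathcomp Require Import all_boot all_order all_algebra.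
From mathcomp Require Import ring lra.
From mathcomp Require Import all_classical all_reals all_analysis.
From mathcomp Require Import measurable_realfun.
Set Implicit Arguments.
Unset Strict Implicit.
Unset Printing Implicit Defensive.
Import Order.TTheory GRing.Theory Num.Theory.
Import numFieldNormedType.Exports.
Local Open Scope classical_set_scope.
Local Open Scope ring_scope.

(** The jump relations of the normal derivative of a simple layer potential.

    Write [w = P - P0]. Since [|w - t n|^2 = |w|^2 - 2 t (w . n) + t^2], the
    difference quotient of the kernel at [P0] along a unit normal [n] is
    [(1/|w - t n| - 1/|w|) / t = a_t - b_t], where with
    [d_t = |w| |w - t n| (|w| + |w - t n|)] one has [a_t = 2 (w . n) / d_t] and
    [b_t = t / d_t]; see [quotient_split].

    The surface being of class C^(1,alpha), [|w . n| <= C |w|^(1 + alpha)] on it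
    ([almost_tangent]). Hence [|w - t n| >= |w| / 2] for small [t], and [a_t] is
    dominated by a multiple of [|w|^(alpha - 2)], which is integrable on the
    surface ([integral_dist3_powR_lty]). By dominated convergence the integral of
    [v a_t] tends to that of [v (w . n) / |w|^3], the direct value of the normal
    derivative.

    The kernel [b_t] is an approximate identity of mass [2 pi]. Away from [P0] it
    tends to [0]. Near [P0] the integral is written in a graph chart, in whatever
    direction the chart is given, and the substitution [x = x0 + t y] blows the
    surface up to its tangent plane. The limit is the integral over that plane of
    [1 / (s sqrt (1 + s^2) (s + sqrt (1 + s^2)))] with [s] the distance to [P0]:
    completing the square makes the slope of the plane disappear, and the
    remaining radial integral is [2 pi] because [s - sqrt (1 + s^2)] increases
    from [-1] to [0] ([integral_jump_kernel_plane], [near_jump_limit]).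

    So the quotient along [n] tends to the direct value minus [2 pi v P0]
    ([normal_derivative_potential]). Replacing [n] by [- n] changes the sign of
    the direct value but not of the jump, which gives the interior derivative. *)

(** * Borel sets of the plane and of space *)

(** A form of second countability that passes to products and only asks the basic
    sets to lie in [M]; with [M] a product sigma-algebra it gives the
    measurability of open sets. *)
Definition countable_base_in (T : topologicalType) (M : set (set T)) :=
  exists B : nat -> set T, (forall n, M (B n)) /\
    forall (U : set T) (x : T), open U -> U x -> exists n, B n x /\ B n `<=` U.

Lemma countable_base_in_real (R : realType) :
  @countable_base_in R (@measurable _ (measurableTypeR R)).
Proof.
pose B n : set R :=
  if @unpickle (rat * rat)%type n is Some pq
  then [set` `](ratr pq.1 : R), (ratr pq.2 : R)[] else set0.
exists B; split=> [n|U x oU Ux].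
  by rewrite /B; case: (unpickle n) => [pq|//]; exact: measurable_itv.
have /nbhs_ballP[e /= e0 eU] : nbhs x U by exact: open_nbhs_nbhs.
have [p /itvP px] : exists q : rat, ratr q \in `]x - e, x[%R.
  by apply: rat_in_itvoo; rewrite ltrBlDr ltrDl.
have [q /itvP qx] : exists q : rat, ratr q \in `]x, x + e[%R.
  by apply: rat_in_itvoo; rewrite ltrDl.
exists (pickle (p, q)); rewrite /B pickleK /=; split=> [|y /=].
  by rewrite in_itv/= px qx.
rewrite in_itv/= => /andP[py yq]; apply: eU.
rewrite /ball/= ltr_distlC; apply/andP; split.
  by rewrite (lt_trans _ py)// px.
by rewrite (lt_trans yq)// qx.
Qed.

Lemma countable_base_inX (T1 T2 : topologicalType)
    (M1 : set (set T1)) (M2 : set (set T2))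
    (M : set (set (T1 * T2))) :
  countable_base_in M1 -> countable_base_in M2 ->
  (forall A B, M1 A -> M2 B -> M (A `*` B)) -> M set0 ->
  countable_base_in M.
Proof.
move=> [B1 [M1B B1P]] [B2 [M2B B2P]] MX M0.
exists (fun n => if @unpickle (nat * nat)%type n is Some ij
                 then B1 ij.1 `*` B2 ij.2 else set0); split=> [n|U [x y] oU Uxy].
  by case: (unpickle n) => [ij|//]; exact: MX.
have [[/= A1 A2] [nA1 nA2] A12] : nbhs (x, y) U by exact: open_nbhs_nbhs.
have [i [B1x B1A]] := B1P _ x (open_interior A1) nA1.
have [j [B2y B2A]] := B2P _ y (open_interior A2) nA2.
exists (pickle (i, j)); rewrite pickleK /=; split=> // -[a b] /= [Ba Bb].
by apply: A12; split => /=; apply: interior_subset; [exact: B1A|exact: B2A].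
Qed.

Section open_measurable_space.
Context (R : realType).
Local Notation mR := (measurableTypeR R).

Lemma countable_base_in_R2 :
  @countable_base_in (R * R)%type (@measurable _ (mR * mR)%type).
Proof.
apply: (countable_base_inX (countable_base_in_real R) (countable_base_in_real R)).
  by move=> A B mA mB; exact: (@measurableX _ _ mR mR).
exact: measurable0.
Qed.

Lemma countable_base_in_R3 :
  @countable_base_in (R * R * R)%type (@measurable _ (mR * mR * mR)%type).
Proof.
apply: (countable_base_inX countable_base_in_R2 (countable_base_in_real R)).
  by move=> A B mA mB; exact: (@measurableX _ _ (mR * mR)%type mR).
exact: measurable0.
Qed.

Lemma countable_base_in_open (T : topologicalType) (M : set (set T)) U :
  countable_base_in M -> M set0 ->
  (forall F : nat -> set T, (forall n, M (F n)) -> M (\bigcup_n F n)) ->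
  open U -> M U.
Proof.
move=> [B [MB BP]] M0 Mbig oU.
have -> : U = \bigcup_n (if `[< B n `<=` U >] then B n else set0).
  apply/seteqP; split=> [x Ux|x [n _]].
    have [n [Bnx BnU]] := BP _ _ oU Ux.
    by exists n => //; rewrite asboolT.
  by case: asboolP => // + Bx; exact.
by apply: Mbig => n; case: asboolP.
Qed.

Lemma open_measurable_R2 (U : set (R * R)) :
  open U -> measurable (U : set (mR * mR)).
Proof.
apply: (countable_base_in_open countable_base_in_R2); first exact: measurable0.
by move=> F mF; exact: bigcupT_measurable.
Qed.

Lemma open_measurable_R3 (U : set (R * R * R)) :
  open U -> measurable (U : set (mR * mR * mR)).
Proof.
apply: (countable_base_in_open countable_base_in_R3); first exact: measurable0.
by move=> F mF; exact: bigcupT_measurable.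
Qed.

Lemma closed_measurable_R3 (U : set (R * R * R)) :
  closed U -> measurable (U : set (mR * mR * mR)).
Proof.
by move=> /closed_openC/open_measurable_R3/measurableC; rewrite setCK.
Qed.

Lemma continuous_measurable_R3 (D : set (R * R * R)) (f : R * R * R -> R) :
  measurable (D : set (mR * mR * mR)) -> {within D, continuous f} ->
  measurable_fun (D : set (mR * mR * mR)) (f : _ -> mR).
Proof.
move=> mD /continuousP cf; apply: (measurability _ (RGenOpens.measurableE R)).
move=> _ [_ [a [b ->] <-]].
have oab : open (`]a, b[%classic : set R) by exact: interval_open.
have /open_subspaceP [V oV VD] := cf _ oab.
rewrite setIC -VD.
by apply: (@measurableI _ (mR * mR * mR)%type) => //; exact: open_measurable_R3.
Qed.

Lemma continuous_measurable_R2 (D : set (R * R)) (f : R * R -> R) :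
  measurable (D : set (mR * mR)) -> {within D, continuous f} ->
  measurable_fun (D : set (mR * mR)) (f : _ -> mR).
Proof.
move=> mD /continuousP cf; apply: (measurability _ (RGenOpens.measurableE R)).
move=> _ [_ [a [b ->] <-]].
have oab : open (`]a, b[%classic : set R) by exact: interval_open.
have /open_subspaceP [V oV VD] := cf _ oab.
rewrite setIC -VD.
by apply: (@measurableI _ (mR * mR)%type) => //; exact: open_measurable_R2.
Qed.

End open_measurable_space.

(** * Integration against an image measure with a density *)

Section density_pushforward.
Context d1 d2 (X : measurableType d1) (Y : measurableType d2) (R : realType).
Variables (mu : {measure set X -> \bar R}) (nu : {measure set Y -> \bar R}).
Variables (phi : X -> Y) (J : X -> R) (D : set Y).
Hypotheses (mphi : measurable_fun setT phi) (mJ : measurable_fun setT J).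
Hypotheses (J0 : forall x, 0 <= J x) (mD : measurable D).
Hypothesis nuE : forall A, measurable A -> A `<=` D ->
  nu A = (\int[mu]_(x in phi @^-1` A) (J x)%:E)%E.
Local Open Scope ereal_scope.
Import HBNNSimple.

Let mphiD A : measurable A -> measurable (phi @^-1` A).
Proof. by move=> mA; rewrite -(setTI (_ @^-1` _)); exact: mphi. Qed.

Let nnsfun_transfer (g : {nnsfun Y >-> R}) :
  \int[nu]_(y in D) (g y)%:E =
  \int[mu]_(x in phi @^-1` D) ((g (phi x))%:E * (J x)%:E).
Proof.
have mg k : measurable (g @^-1` [set k]) by exact: measurable_sfunP.
transitivity (\sum_(k \in range g)
    \int[nu]_(y in D) (k * \1_(g @^-1` [set k]) y)%:E).
  under eq_integral do rewrite fimfunE -fsumEFin//.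
  rewrite ge0_integral_fsum//.
    by move=> r; exact/measurable_EFinP/measurable_funM.
  by move=> n y _; rewrite nnfun_muleindic_ge0.
transitivity (\sum_(k \in range g)
    \int[mu]_(x in phi @^-1` D) ((k * \1_(g @^-1` [set k]) (phi x))%:E * (J x)%:E)).
  apply: eq_fsbigr => k; rewrite inE => -[y0 _ gk].
  have k0 : (0 <= k)%R by rewrite -gk.
  under eq_integral do rewrite EFinM.
  rewrite ge0_integralZl//; first last.
    exact/measurable_EFinP/measurable_funTS/measurable_indic.
  rewrite integral_indic// nuE//; last exact: measurableI.
  under [RHS]eq_integral do rewrite EFinM -muleA.
  rewrite ge0_integralZl//; last 3 first.
    exact: mphiD.
    apply: emeasurable_funM; apply/measurable_EFinP/measurable_funTS => //.
    by apply: measurableT_comp => //; exact: measurable_indic.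
    by move=> x _; rewrite mule_ge0 ?lee_fin.
  congr (_ * _).
  rewrite preimage_setI integral_mkcondl; apply: eq_integral => x _.
  rewrite patchE indicE.
  have -> : (x \in phi @^-1` (g @^-1` [set k])) = (phi x \in g @^-1` [set k]).
    by apply/idP/idP; rewrite !inE.
  by case: ifPn => _; rewrite ?mul1e ?mul0e.
rewrite -ge0_integral_fsum//.
- apply: eq_integral => x _.
  rewrite [in RHS](fimfunE g) -fsumEFin// ge0_mule_fsuml//.
  by move=> i; rewrite EFinM nnfun_muleindic_ge0.
- exact: mphiD.
- move=> k; apply: emeasurable_funM; apply/measurable_EFinP/measurable_funTS => //.
  apply: measurable_funM => //.
  by apply: measurableT_comp => //; exact: measurable_indic.
- move=> k x _; apply: mule_ge0; last by rewrite lee_fin.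
  by rewrite EFinM nnfun_muleindic_ge0.
Qed.

(** [nu] is known on the subsets of [D] only, where it is the image under [phi] of
    the measure of density [J]; simple functions and monotone convergence carry
    the identity from sets to functions. *)
Lemma ge0_integral_density_pushforward (h : Y -> \bar R) :
  measurable_fun D h -> (forall y, D y -> 0 <= h y) ->
  \int[nu]_(y in D) h y = \int[mu]_(x in phi @^-1` D) (h (phi x) * (J x)%:E).
Proof.
move=> mh h0; pose h_ := nnsfun_approx mD mh.
transitivity (limn (fun n => \int[nu]_(y in D) (h_ n y)%:E)).
  rewrite -monotone_convergence//.
  - by apply: eq_integral => y /[!inE] yD; apply/esym/cvg_lim => //;
      exact: cvg_nnsfun_approx.
  - by move=> n; exact/measurable_EFinP/measurable_funP.
  - by move=> n y _; rewrite lee_fin.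
  - by move=> y _ m n mn; rewrite lee_fin; exact/lefP/nd_nnsfun_approx.
under eq_fun do rewrite nnsfun_transfer.
rewrite -monotone_convergence//.
- apply: eq_integral => x /[!inE] xD; apply/cvg_lim => //.
  by apply: cvgeZr => //; exact: cvg_nnsfun_approx.
- exact: mphiD.
- move=> n; apply: emeasurable_funM; apply/measurable_EFinP/measurable_funTS => //.
  by apply: measurableT_comp => //; exact: measurable_funP.
- by move=> n x _; rewrite mule_ge0 ?lee_fin.
- move=> x _ m n mn; rewrite lee_wpmul2r ?lee_fin//.
  exact/lefP/nd_nnsfun_approx.
Qed.

End density_pushforward.

(** * Affine substitutions *)

Section affine_substitution.
Context (R : realType).
Local Notation mR := (measurableTypeR R).
Local Notation leb := (@lebesgue_measure R).
Local Open Scope ereal_scope.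

(** Lebesgue measure is determined by its values on half-open intervals, so it
    equals [c] times its image under the affine map. *)
Lemma ge0_integral_affine (c d : R) (F : R -> \bar R) : (0 < c)%R ->
  measurable_fun (setT : set mR) F -> (forall x, 0 <= F x) ->
  \int[leb]_x F (c * x + d)%R = (c^-1)%:E * \int[leb]_x F x.
Proof.
move=> c0 mF F0.
have mphi : measurable_fun [set: mR] (fun x : mR => (c * x + d)%R : mR).
  by apply: measurable_funD => //; exact: measurable_funM.
pose cnn := NngNum (ltW c0).
pose m0 : {measure set mR -> \bar R} :=
  mscale cnn (pushforward leb (fun x : mR => (c * x + d)%R : mR)).
pose m' := m0 mphi.
have m'E A : measurable A -> leb A = m' A.
  apply: lebesgue_measure_unique => _ [[a b] _ <-] /=.
  rewrite /mscale/= /pushforward.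
  have -> : (fun x => (c * x + d)%R) @^-1` `]a, b]%classic =
            `](a - d) / c, (b - d) / c]%classic%R.
    apply/seteqP; split=> x /=; rewrite !in_itv/= ltr_pdivrMr// ler_pdivlMr//;
      by rewrite ltrBlDr lerBrDr (mulrC x).
  rewrite !lebesgue_measure_itv/= !lte_fin ltr_pM2r ?invr_gt0// ltrD2r.
  case: ifPn => ab; last by rewrite mule0.
  by rewrite -!EFinD -EFinM; congr EFin; field; rewrite gt_eqF.
have -> : \int[leb]_x F x = \int[m']_x F x.
  by apply: eq_measure_integral => A mA _; exact: m'E.
rewrite ge0_integral_mscale//= ge0_integral_pushforward//= preimage_setT.
by rewrite muleA -EFinM mulVf ?gt_eqF// mul1e.
Qed.

Local Notation leb2 := (@lebesgue_measure R \x @lebesgue_measure R).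
Local Notation R2 := (mR * mR)%type.

(** For a fixed second coordinate the map is affine in the first one, so that
    Tonelli reduces the claim to one dimension. Triangular maps are enough both
    for homotheties and for completing a square. *)
Lemma ge0_integral_triangular (p q r c d : R) (F : R * R -> \bar R) :
  (0 < p)%R -> (0 < r)%R ->
  measurable_fun [set: R2] F -> (forall z, 0 <= F z) ->
  \int[leb2]_z F (p * z.1 + q * z.2 + c, r * z.2 + d)%R =
  ((p * r)^-1)%:E * \int[leb2]_z F z.
Proof.
move=> p0 r0 mF F0.
have mA : measurable_fun [set: R2]
    (fun z : R2 => ((p * z.1 + q * z.2 + c)%R, (r * z.2 + d)%R) : R2).
  apply/measurable_fun_pairP; split => /=.
    apply: measurable_funD => //; apply: measurable_funD => //;
    exact: measurable_funM.
  by apply: measurable_funD => //; exact: measurable_funM.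
rewrite fubini_tonelli2//; last exact: measurableT_comp mA.
rewrite [in RHS]fubini_tonelli2//.
have G0 y : 0 <= fubini_G leb F y by apply: integral_ge0.
have mG : measurable_fun [set: mR] (fubini_G leb F).
  exact: measurable_fun_fubini_tonelli_G.
transitivity (\int[leb]_y ((p^-1)%:E * fubini_G leb F (r * y + d)%R)).
  apply: eq_integral => y _; rewrite /fubini_G/=.
  under eq_integral do rewrite -addrA.
  rewrite (@ge0_integral_affine p (q * y + c)%R (fun x => F (x, (r * y + d)%R)))//.
  exact: measurableT_comp.
rewrite ge0_integralZl; last 4 first.
- exact: measurableT.
- apply: (measurableT_comp mG).
  by apply: measurable_funD => //; exact: measurable_funM.
- by move=> y _; exact: G0.
- by rewrite lee_fin invr_ge0 ltW.
by rewrite (ge0_integral_affine _ _ mG)// muleA -EFinM -invfM.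
Qed.

End affine_substitution.

(** * Radial functions of two variables *)

Section polar_integration.
Context (R : realType).
Local Notation mR := (measurableTypeR R).
Local Notation leb := (@lebesgue_measure R).
Local Notation leb2 := (@lebesgue_measure R \x @lebesgue_measure R)%E.
Local Notation R2 := (mR * mR)%type.
Local Open Scope ereal_scope.

Lemma integralT_oneDsqrV : \int[leb]_x ((1 + x ^+ 2)^-1)%:E = (pi : R)%:E.
Proof.
have -> : (pi : R)%:E = 2%:E * (pi / 2 : R)%:E.
  by rewrite -EFinM; congr EFin; field.
rewrite -integral0y_oneDsqr.
rewrite (@ge0_symfun_integralT _ (fun x => (1 + x ^+ 2)^-1)%R)//.
- by rewrite set_itvcy.
- by move=> x; rewrite invr_ge0 addr_ge0// sqr_ge0.
- exact: continuous_oneDsqrV.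
- by move=> x /=; rewrite sqrrN.
Qed.

(** The substitution [z.1 = |z.2| u] turns the integral of a radial function
    into a product of the integral of [(1 + u^2)^-1] and a one-dimensional
    integral, which replaces polar coordinates. *)
Lemma ge0_integral_radial (g : R -> \bar R) :
  measurable_fun [set: mR] g -> (forall x, 0 <= g x) ->
  \int[leb2]_z g (z.1 ^+ 2 + z.2 ^+ 2)%R =
  pi%:E * \int[leb]_r (`|r|%:E * g (r ^+ 2)%R).
Proof.
move=> mg g0.
have msq : measurable_fun [set: R2] (fun z : R2 => (z.1 ^+ 2 + z.2 ^+ 2)%R : mR).
  by apply: measurable_funD; apply: measurable_funX.
rewrite fubini_tonelli2//; last exact: (measurableT_comp mg msq).
pose H (z : R2) := `|z.2|%:E * g (z.2 ^+ 2 * (1 + z.1 ^+ 2))%R.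
have mnorm2 : measurable_fun [set: R2] (fun z : R2 => `|z.2|%:E : \bar R).
  by apply/measurable_EFinP; apply: measurableT_comp.
have mH : measurable_fun [set: R2] H.
  apply: emeasurable_funM => //; apply: (measurableT_comp mg).
  apply: measurable_funM; first exact: measurable_funX.
  by apply: measurable_funD => //; exact: measurable_funX.
have H0 z : 0 <= H z by rewrite mule_ge0// lee_fin.
transitivity (\int[leb]_y \int[leb]_x H (x, y)).
  apply: ge0_ae_eq_integral => //.
  - apply: measurable_fun_fubini_tonelli_G => //.
    exact: (measurableT_comp mg msq).
  - exact: (@measurable_fun_fubini_tonelli_G _ _ _ _ _ _ H).
  - by move=> y _; apply: integral_ge0.
  - by move=> y _; apply: integral_ge0.
  (* The substitution degenerates on the line [y = 0], which is null. *)
  exists [set 0%R]; split => //; first exact: lebesgue_measure_set1.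
  move=> y /= /not_implyP[_ yH]; apply: contrapT => /eqP y0; apply: yH.
  have ny : (0 < `|y|)%R by rewrite normr_gt0.
  rewrite /H/= ge0_integralZl//.
  - have := @ge0_integral_affine R `|y|%R 0%R (fun x => g (x ^+ 2 + y ^+ 2)%R) ny.
    move=> aff; rewrite (_ : (fun x => _) = (fun x : R => g ((`|y| * x + 0) ^+ 2 + y ^+ 2)%R)).
      rewrite aff// ?muleA -?EFinM ?divff ?gt_eqF ?mul1e//.
      apply: (measurableT_comp mg).
      by apply: measurable_funD => //; exact: measurable_funX.
    apply/funext => x; congr g; rewrite addr0 exprMn real_normK ?num_real//.
    by rewrite mulrDr mulr1 addrC.
  - apply: (measurableT_comp mg); apply: measurable_funM => //.
    by apply: measurable_funD => //; exact: measurable_funX.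
rewrite -(fubini_tonelli _ mH H0).
pose G r := `|r|%:E * g (r ^+ 2)%R.
have G0 r : 0 <= G r by rewrite mule_ge0// lee_fin.
have mG : measurable_fun [set: mR] G.
  apply: emeasurable_funM; first by apply/measurable_EFinP; exact: normr_measurable.
  by apply: (measurableT_comp mg); exact: measurable_funX.
have IG0 : 0 <= \int[leb]_r G r by apply: integral_ge0.
transitivity (\int[leb]_x (((1 + x ^+ 2)^-1)%:E * \int[leb]_r G r)); last first.
  rewrite ge0_integralZr//.
  - by rewrite integralT_oneDsqrV.
  - apply/measurable_EFinP; apply: continuous_measurable_fun.
    exact: continuous_oneDsqrV.
  - by move=> x _; rewrite lee_fin invr_ge0 addr_ge0// sqr_ge0.
apply: eq_integral => x _.
have s0 : (0 < 1 + x ^+ 2)%R by rewrite ltr_pwDl// sqr_ge0.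
have rs0 : (0 < Num.sqrt (1 + x ^+ 2))%R by rewrite sqrtr_gt0.
transitivity (\int[leb]_y ((Num.sqrt (1 + x ^+ 2))^-1%:E *
                           G (Num.sqrt (1 + x ^+ 2) * y + 0)%R)).
  apply: eq_integral => y _; rewrite /H /G/= addr0 exprMn sqr_sqrtr ?(ltW s0)//.
  rewrite normrM (gtr0_norm rs0) muleA -EFinM mulrA mulVf ?gt_eqF// mul1r.
  by rewrite mulrC.
rewrite ge0_integralZl; last 4 first.
- exact: measurableT.
- apply: (measurableT_comp mG).
  by apply: measurable_funD => //; exact: measurable_funM.
- by move=> y _; exact: G0.
- by rewrite lee_fin invr_ge0 ltW.
rewrite (ge0_integral_affine _ rs0 mG)// muleA -EFinM -invfM -expr2.
by rewrite sqr_sqrtr ?(ltW s0).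
Qed.

(** Completing the square reduces the metric of the tangent plane of slope [a]
    to the Euclidean one; the determinant is the square of the area element. *)
Lemma ge0_integral_radial_slope (a1 a2 : R) (g : R -> \bar R) :
  measurable_fun [set: mR] g -> (forall x, 0 <= g x) ->
  \int[leb2]_z g (z.1 ^+ 2 + z.2 ^+ 2 + (a1 * z.1 + a2 * z.2) ^+ 2)%R =
  ((Num.sqrt (1 + a1 ^+ 2 + a2 ^+ 2))^-1)%:E *
  (pi%:E * \int[leb]_r (`|r|%:E * g (r ^+ 2)%R)).
Proof.
move=> mg g0; rewrite -ge0_integral_radial//.
set J := Num.sqrt (1 + a1 ^+ 2 + a2 ^+ 2).
have J2 : (J ^+ 2 = 1 + a1 ^+ 2 + a2 ^+ 2)%R.
  by rewrite sqr_sqrtr// !addr_ge0// sqr_ge0.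
have J0 : (0 < J)%R by rewrite sqrtr_gt0 -addrA ltr_pwDl// addr_ge0// sqr_ge0.
pose p := Num.sqrt (1 + a1 ^+ 2).
have p2 : (p ^+ 2 = 1 + a1 ^+ 2)%R by rewrite sqr_sqrtr// addr_ge0// sqr_ge0.
have p0 : (0 < p)%R by rewrite sqrtr_gt0 ltr_pwDl// sqr_ge0.
have -> : J = (p * (J / p))%R by rewrite mulrCA divff ?mulr1// gt_eqF.
rewrite -(@ge0_integral_triangular R p (a1 * a2 / p)%R (J / p)%R 0%R 0%R
  (fun z => g (z.1 ^+ 2 + z.2 ^+ 2)%R))//.
- apply: eq_integral => z _ /=; congr g.
  rewrite !addr0 -[X in (X + _)%R]addr0.
  have pn : p != 0%R by rewrite gt_eqF.
  apply: (mulIf (lt0r_neq0 (exprn_gt0 2 p0))).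
  have -> : (((p * z.1 + a1 * a2 / p * z.2) ^+ 2 + (J / p * z.2) ^+ 2) * p ^+ 2 =
     (p ^+ 2 * z.1 + a1 * a2 * z.2) ^+ 2 + J ^+ 2 * z.2 ^+ 2)%R by field.
  by rewrite p2 J2; ring.
- by rewrite divr_gt0.
- apply: (measurableT_comp mg).
  by apply: measurable_funD; apply: measurable_funX.
Qed.

End polar_integration.

(** * The radial integrals of the jump and of weak singularities *)

Section radial_integrals.
Context (R : realType).
Local Notation mR := (measurableTypeR R).
Local Notation leb := (@lebesgue_measure R).
Local Notation leb2 := (@lebesgue_measure R \x @lebesgue_measure R)%E.
Local Notation R2 := (mR * mR)%type.

Lemma ge0_integral_even (F : R -> \bar R) :
  measurable_fun [set: mR] F -> (forall x, 0 <= F x)%E ->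
  (forall x, F (- x) = F x) ->
  (\int[leb]_x F x = 2%:E * \int[leb]_(x in `[0%R, +oo[) F x)%E.
Proof.
move=> mF F0 Fev; have mP : measurable (`[0%R, +oo[%classic : set mR) by [].
rewrite -(setUv `[0%R, +oo[%classic) ge0_integral_setU//=; last 3 first.
- exact: measurableC.
- exact: measurable_funTS.
- exact/disj_setPCl.
rewrite mule_natl mule2n; congr +%E.
rewrite setCitvr integral_itv_bndo_bndc; last exact: measurable_funTS.
rewrite ge0_integration_by_substitution0//.
by apply: eq_integral => x _; rewrite Fev.
Qed.

(** The integrand is unbounded at [0] when [b < 1]: the fundamental theorem of
    calculus applies on the segments [r / n.+2, r], which exhaust the interval. *)
Lemma integral_powR_le (b r : R) : 0 < b -> 0 < r ->
  (\int[leb]_(x in `]0%R, r]) (x `^ (b - 1))%:E <= (r `^ b / b)%:E)%E.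
Proof.
move=> b0 r0.
pose F n : set mR := `[r / n.+2%:R, r]%classic.
have F0 n x : F n x -> 0 < x.
  by rewrite /F/= in_itv/= => /andP[+ _]; apply: lt_le_trans; rewrite divr_gt0.
have UF : \bigcup_n F n = `]0, r]%classic.
  apply/seteqP; split=> [x [n _ Fx]|x /=].
    by rewrite /= in_itv/= (F0 _ _ Fx); move: Fx; rewrite /F/= in_itv/= => /andP[].
  rewrite in_itv/= => /andP[x0 xr].
  exists (Num.truncn (r / x)) => //; rewrite /F/= in_itv/= xr andbT.
  rewrite ler_pdivrMr// mulrC -ler_pdivrMr//.
  apply: le_trans (ltW (truncnS_gt _)) _.
  by rewrite ler_nat.
have ndF : nondecreasing_seq F.
  move=> m n mn; apply/subsetPset => x; rewrite /F/= !in_itv/= => /andP[lx ->].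
  rewrite andbT (le_trans _ lx)// ler_pM2l// lef_pV2 ?posrE// ler_nat.
  by rewrite !ltnS.
have cvgF := @ge0_nondecreasing_set_cvg_integral _ _ _ F
  (fun x => (x `^ (b - 1))%:E) leb ndF.
rewrite -UF -(cvg_lim _ (cvgF _ _ _))//; last 3 first.
- by move=> i; exact: measurable_itv.
- move=> i; apply/measurable_EFinP.
  by apply: measurable_funTS; exact: measurable_powR.
- by move=> i x _; rewrite lee_fin powR_ge0.
apply: lime_le.
  apply/cvg_ex; eexists; apply: cvgF.
  + by move=> i; exact: measurable_itv.
  + move=> i; apply/measurable_EFinP.
    by apply: measurable_funTS; exact: measurable_powR.
  + by move=> i x _; rewrite lee_fin powR_ge0.
near=> n; set a := r / n.+2%:R.
have a0 : 0 < a by rewrite divr_gt0.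
have ar : a < r by rewrite ltr_pdivrMr// ltr_pMr// ltr1n.
have dF (x : R) : 0 < x -> is_derive x 1 (fun x => b^-1 * x `^ b) (x `^ (b - 1)).
  move=> x0; have dp := @is_derive1_powR R b x x0.
  have := is_deriveZ b^-1 dp.
  by rewrite /GRing.scale/= mulrA mulVf ?gt_eqF// mul1r.
have cF (x : R) : 0 < x -> {for x, continuous (fun x => b^-1 * x `^ b)}.
  move=> x0; apply: differentiable_continuous; apply/derivable1_diffP.
  by have [] := dF x x0.
rewrite (@continuous_FTC2 _ _ (fun x => b^-1 * x `^ b))//.
- rewrite -EFinB lee_fin mulrC lerBlDr lerDl mulr_ge0 ?powR_ge0//.
  by rewrite invr_ge0 ltW.
- apply: derivable_within_continuous => x; rewrite in_itv/= => /andP[ax _].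
  by apply: derivable_powR; rewrite in_itv/= andbT (lt_le_trans a0).
- split.
  + move=> x; rewrite in_itv/= => /andP[ax _].
    by have [] := dF x (lt_trans a0 ax).
  + by apply: cvg_at_right_filter; exact: cF.
  + by apply: cvg_at_left_filter; exact: cF.
- move=> x; rewrite in_itv/= => /andP[ax _].
  by rewrite derive1E; have [_ ->] := dF x (lt_trans a0 ax).
Unshelve. all: by end_near. Qed.

(** The kernel [1 / (s * sqrt (1 + s^2) * (s + sqrt (1 + s^2)))] as a function of
    [s^2], so that it can be composed with a quadratic form. *)
Definition jump_kernel (x : R) : R :=
  (Num.sqrt x * Num.sqrt (1 + x) * (Num.sqrt x + Num.sqrt (1 + x)))^-1.

Lemma jump_kernel_ge0 x : 0 <= jump_kernel x.
Proof. by rewrite invr_ge0 !mulr_ge0// addr_ge0. Qed.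

Lemma measurable_sqrtr : measurable_fun [set: mR] (@Num.sqrt R : _ -> mR).
Proof. by apply: continuous_measurable_fun; exact: sqrt_continuous. Qed.

Lemma measurable_invr : measurable_fun [set: mR] (@GRing.inv R : _ -> mR).
Proof.
have -> : [set: mR] = [set~ 0%R] `|` [set 0%R] by rewrite setvU.
apply/measurable_funU.
- exact: measurableC.
- exact: measurable_set1.
split; last exact: measurable_fun_set1.
apply: open_continuous_measurable_fun => [|x]; first exact: closed_openC.
by rewrite inE/= => /eqP x0; exact: inv_continuous.
Qed.

Lemma measurable_jump_kernel : measurable_fun [set: mR] (jump_kernel : _ -> mR).
Proof.
have m1 : measurable_fun [set: mR] (fun x : R => Num.sqrt (1 + x) : mR).
  by apply: (measurableT_comp measurable_sqrtr); exact: measurable_funD.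
have m0 := measurable_sqrtr.
apply: (measurableT_comp measurable_invr).
by apply: measurable_funM; [exact: measurable_funM|exact: measurable_funD].
Qed.

Let sq (x : R) : R := Num.sqrt (1 + x ^+ 2).

Let oneDsqr0 (x : R) : 0 < 1 + x ^+ 2.
Proof. by rewrite ltr_pwDl// sqr_ge0. Qed.

Let sq_gt0 x : 0 < sq x. Proof. by rewrite sqrtr_gt0. Qed.

Let sq_gt x : `|x| < sq x.
Proof.
by rewrite -sqrtr_sqr ltr_sqrt ?oneDsqr0// ltrDr.
Qed.

Let sqD_gt0 x : 0 < x + sq x.
Proof. by have := sq_gt x; rewrite ltr_norml => /andP[+ _]; lra. Qed.

(** On the half line the integrand is [1 / (s (r + s))] with
    [s = sqrt (1 + r ^+ 2)], whose primitive [r - s] increases from [-1] to [0]. *)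
Lemma integral_jump_kernel :
  (\int[leb]_r (`|r|%:E * (jump_kernel (r ^+ 2))%:E) = 2%:E)%E.
Proof.
pose f (x : R) : R := (sq x * (x + sq x))^-1.
have csq : continuous sq.
  move=> x; exact: (@continuous_comp R R R (fun x => 1 + x ^+ 2) Num.sqrt x
    (@continuous_oneDsqr R x) (@sqrt_continuous R _)).
have cf : continuous f.
  move=> x; apply: cvgV; first by rewrite gt_eqF// mulr_gt0.
  by apply: cvgM; [exact: csq|apply: cvgD; [exact: cvg_id|exact: csq]].
have mk : measurable_fun [set: mR] (fun r : R => `|r|%:E * (jump_kernel (r ^+ 2))%:E)%E.
  apply: emeasurable_funM; apply/measurable_EFinP; first exact: normr_measurable.
  by apply: (measurableT_comp measurable_jump_kernel); exact: measurable_funX.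
rewrite ge0_integral_even//; last 2 first.
- by move=> x; rewrite mule_ge0 ?lee_fin// jump_kernel_ge0.
- by move=> x; rewrite normrN sqrrN.
suff -> : (\int[leb]_(x in `[0%R, +oo[) (`|x|%:E * (jump_kernel (x ^+ 2))%:E) = 1)%E.
  by rewrite mule1.
rewrite -integral_itv_obnd_cbnd; last exact: measurable_funTS.
transitivity (\int[leb]_(x in `]0%R, +oo[) (f x)%:E)%E.
  apply: eq_integral => x; rewrite inE/= in_itv/= andbT => x0.
  rewrite -EFinM; congr EFin; rewrite /jump_kernel sqrtr_sqr gtr0_norm// /f.
  rewrite -/(sq x) -mulrA [in LHS]invfM mulrA divff ?gt_eqF// mul1r.
  by [].
rewrite integral_itv_obnd_cbnd; last first.
  apply/measurable_EFinP; apply: measurable_funTS.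
  exact: continuous_measurable_fun.
have dsq (x : R) : is_derive x 1 sq (x / sq x).
  have dX : is_derive x 1 (fun x : R => x ^+ 2) (2 * x).
    apply: DeriveDef; first exact: exprn_derivable.
    by rewrite exp_derive expr1 /GRing.scale/= mulr1.
  have d1 : is_derive x 1 (fun x : R => 1 + x ^+ 2) (0 + 2 * x).
    have -> : (fun x : R => 1 + x ^+ 2) = cst (1 : R) + (fun x : R => x ^+ 2) by [].
    by apply: is_deriveD; exact: is_derive_cst.
  have d2 := is_derive1_sqrt (oneDsqr0 x).
  have := @is_derive1_comp _ Num.sqrt (fun x : R => 1 + x ^+ 2) x _ _ d2 d1.
  rewrite add0r -/(sq x) (_ : _ * _ = x / sq x)//.
  by field; rewrite gt_eqF.
rewrite (@ge0_continuous_FTC2y _ f (fun x => x - sq x) 0%R 0%R).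
- by rewrite /sq expr0n/= addr0 sqrtr1 sub0r -EFinB sub0r opprK.
- by move=> x _; rewrite invr_ge0 ltW// mulr_gt0.
- exact: continuous_subspaceT.
- have -> : (fun x => x - sq x) = (fun x => - (x + sq x)^-1).
    apply/funext => x; have sx := sqD_gt0 x.
    apply: (mulIf (lt0r_neq0 sx)); rewrite mulNr mulVf ?gt_eqF//.
    rewrite mulrDr !mulrDl; have := sqr_sqrtr (ltW (oneDsqr0 x)).
    by rewrite -/(sq x) expr2 => h; rewrite mulNr [_ * sq x as X in _ + X]mulrC; lra.
  rewrite -[X in _ --> X]oppr0; apply: cvgN.
  have posD : \forall x \near +oo, 0 < x + sq x by apply: nearW; exact: sqD_gt0.
  apply: (gtr0_cvgV0 posD).2.
  apply/cvgryPge => A; near=> x.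
  have := sq_gt0 x; have : A <= x by near: x; apply: nbhs_pinfty_ge; exact: num_real.
  lra.
- move=> x _; apply: derivableB => //; by have [] := dsq x.
- apply: cvg_at_right_filter; apply: cvgB; first exact: cvg_id.
  exact: csq.
- move=> x _; have [dq dqE] := dsq x.
  rewrite derive1E deriveB; [|exact: derivable_id|exact: dq].
  rewrite derive_id dqE /f.
  have sx := sqD_gt0 x; have s0 := sq_gt0 x.
  have h : sq x * sq x = 1 + x ^+ 2 by rewrite -expr2 sqr_sqrtr// ltW.
  apply: (mulIf (lt0r_neq0 (mulr_gt0 s0 sx))).
  rewrite mulVf ?gt_eqF ?mulr_gt0// mulrBl mul1r mulrA divfK ?gt_eqF//.
  by rewrite mulrDr h; ring.
Unshelve. all: by end_near. Qed.

(** The origin of the constant of the jump relation: on every tangent plane,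
    whatever its slope, the kernel has the same mass for the surface measure. *)
Lemma integral_jump_kernel_plane (a1 a2 : R) :
  (\int[leb2]_z (jump_kernel (z.1 ^+ 2 + z.2 ^+ 2 + (a1 * z.1 + a2 * z.2) ^+ 2))%:E
   = (2 * pi / Num.sqrt (1 + a1 ^+ 2 + a2 ^+ 2))%:E)%E.
Proof.
rewrite (@ge0_integral_radial_slope R a1 a2 (EFin \o jump_kernel)).
- by rewrite integral_jump_kernel -!EFinM; congr EFin; rewrite mulrC (mulrC pi).
- by apply/measurable_EFinP; exact: measurable_jump_kernel.
- by move=> x; rewrite lee_fin jump_kernel_ge0.
Qed.

(** Comparable to [jump_kernel] and free of the slope of the tangent plane. *)
Definition jump_bound (x : R) : R := (Num.sqrt x * (1 + x))^-1.

Lemma measurable_jump_bound : measurable_fun [set: mR] (jump_bound : _ -> mR).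
Proof.
apply: (measurableT_comp measurable_invr); apply: measurable_funM.
  exact: measurable_sqrtr.
exact: measurable_funD.
Qed.

Lemma integral_jump_bound_plane_lty :
  (\int[leb2]_z `|jump_bound (z.1 ^+ 2 + z.2 ^+ 2)|%:E < +oo)%E.
Proof.
have mb : measurable_fun [set: mR] (fun x => `|jump_bound x| : mR).
  by apply: measurableT_comp => //; exact: measurable_jump_bound.
rewrite (@ge0_integral_radial R (fun x => `|jump_bound x|%:E)%E).
- apply: lte_mul_pinfty; rewrite ?lee_fin ?pi_ge0//.
  apply: (@le_lt_trans _ _ (pi : R)%:E); last exact: ltry.
  rewrite -integralT_oneDsqrV; apply: ge0_le_integral => //.
  + apply: emeasurable_funM; apply/measurable_EFinP; first exact: normr_measurable.
    by apply: (measurableT_comp mb); exact: measurable_funX.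
  + apply/measurable_EFinP; apply: continuous_measurable_fun.
    exact: continuous_oneDsqrV.
  + move=> x _; rewrite -EFinM lee_fin /jump_bound sqrtr_sqr invfM normrM !normfV.
    rewrite normr_id (gtr0_norm (oneDsqr0 x)) mulrA.
    have [->|x0] := eqVneq x 0; first by rewrite normr0 !mul0r invr_ge0 ltW.
    by rewrite divff ?mul1r// normr_eq0.
- exact/measurable_EFinP.
- by move=> x; rewrite lee_fin.
Qed.

Lemma integral_powR_disc_lty (b r : R) : 0 < b -> 0 < r ->
  (\int[leb2]_z (if (z.1 ^+ 2 + z.2 ^+ 2 < r ^+ 2)%R
                 then Num.sqrt (z.1 ^+ 2 + z.2 ^+ 2) `^ (b - 2) else 0)%:E < +oo)%E.
Proof.
move=> b0 r0.
pose g (x : R) : R := if x < r ^+ 2 then Num.sqrt x `^ (b - 2) else 0.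
have mp : measurable_fun [set: mR] (fun x : mR => x `^ (b - 2) : mR).
  exact: measurable_powR.
have mg : measurable_fun [set: mR] (g : _ -> mR).
  apply: measurable_fun_if => //.
  - exact: measurable_fun_ltr.
  - apply: measurable_funTS; exact: (measurableT_comp mp measurable_sqrtr).
have g0 x : 0 <= g x by rewrite /g; case: ifP => // _; exact: powR_ge0.
have mk : measurable_fun [set: mR] (fun x : R => `|x|%:E * (g (x ^+ 2))%:E)%E.
  apply: emeasurable_funM; apply/measurable_EFinP; first exact: normr_measurable.
  by apply: (measurableT_comp mg); exact: measurable_funX.
rewrite (@ge0_integral_radial R (EFin \o g)).
- apply: lte_mul_pinfty; rewrite ?lee_fin ?pi_ge0//.
  rewrite ge0_integral_even; last 3 first.
  + exact: mk.
  + by move=> x; rewrite mule_ge0 ?lee_fin/=.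
  + by move=> x; rewrite normrN sqrrN.
  apply: lte_mul_pinfty => //.
  rewrite -integral_itv_obnd_cbnd; last exact: measurable_funTS.
  apply: (@le_lt_trans _ _ (r `^ b / b)%:E); last exact: ltry.
  apply: le_trans (integral_powR_le b0 r0).
  rewrite integral_mkcond [leRHS]integral_mkcond.
  apply: ge0_le_integral => //.
  + by move=> x _; rewrite patchE; case: ifP => // _; rewrite mule_ge0 ?lee_fin/=.
  + exact: ((measurable_restrictT _ (measurable_itv _)).1 (measurable_funTS mk)).
  + apply: (measurable_restrictT _ (measurable_itv _)).1.
    by apply/measurable_EFinP; apply: measurable_funTS; exact: measurable_powR.
  + move=> x _; rewrite !patchE !mem_setE !in_itv/= andbT.
    have [x0|x0]/= := ltP 0 x; last by [].
    have -> : g (x ^+ 2) = if x < r then Num.sqrt (x ^+ 2) `^ (b - 2) else 0.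
      by rewrite /g ltr_pXn2r// nnegrE ltW.
    have [xr|xr] := ltP x r; last first.
      by rewrite mule0; case: ifP => // _; rewrite lee_fin powR_ge0.
    rewrite (ltW xr) -EFinM lee_fin sqrtr_sqr gtr0_norm//.
    have -> : b - 1 = 1 + (b - 2) by ring.
    by rewrite [leRHS]powRD; [rewrite powRr1// ltW|rewrite (gt_eqF x0) implybT].
- exact/measurable_EFinP.
- by move=> x; rewrite lee_fin.
Qed.

End radial_integrals.

(** * Euclidean geometry in graph coordinates *)

(* Not the coordinates of a vector in a basis. *)
Local Notation coord := Defs.coord.

Section coordinates.
Context (R : realType).
Implicit Types (k : 'I_3) (x y : R * R) (s t : R) (P Q M : R * R * R).

Lemma put_coord k P : put k (drop_coord k P) (coord k P) = P.
Proof. by case: P => [[a b] c]; case: k => -[|[|[|//]]] ?. Qed.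

Lemma drop_coord_put k x t : drop_coord k (put k x t) = x.
Proof. by case: x => [a b]; case: k => -[|[|[|//]]] ?. Qed.

Lemma putB k x y s t : put k x s - put k y t = put k (x - y) (s - t).
Proof. by case: x y => [a b] [c d]; case: k => -[|[|[|//]]] ?. Qed.

Lemma dot3_put k x y s t :
  dot3 (put k x s) (put k y t) = x.1 * y.1 + x.2 * y.2 + s * t.
Proof. by case: k => -[|[|[|//]]] ?; rewrite /dot3/put/=; ring. Qed.

(** A vector orthogonal to both coordinate tangents only sees the height above
    the tangent plane. *)
Lemma dot3_normal k n (a1 a2 : R) y s :
  dot3 n (put k (1, 0) a1) = 0 -> dot3 n (put k (0, 1) a2) = 0 ->
  dot3 (put k y s) n = coord k n * (s - (y.1 * a1 + y.2 * a2)).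
Proof.
have := put_coord k n; set m := drop_coord k n; set h := coord k n => <-.
rewrite !dot3_put /= => t1 t2.
have -> : m.1 = - (h * a1) by move: t1; rewrite mulr1 mulr0; lra.
have -> : m.2 = - (h * a2) by move: t2; rewrite mulr1 mulr0; lra.
by ring.
Qed.

Lemma dot3_ge0 P : 0 <= dot3 P P.
Proof. by rewrite /dot3 !addr_ge0// -expr2 sqr_ge0. Qed.

Lemma sqr_enorm3 P : enorm3 P ^+ 2 = dot3 P P.
Proof. by rewrite sqr_sqrtr// dot3_ge0. Qed.

Lemma enorm3_ge0 P : 0 <= enorm3 P.
Proof. exact: sqrtr_ge0. Qed.

Lemma enorm3N P : enorm3 (- P) = enorm3 P.
Proof. by rewrite /enorm3 /dot3/= !mulrNN. Qed.

Lemma dist3C P M : dist3 P M = dist3 M P.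
Proof. by rewrite /dist3 -enorm3N opprB. Qed.

Lemma dist3_ge0 P M : 0 <= dist3 P M.
Proof. exact: enorm3_ge0. Qed.

Lemma enorm3Z t P : enorm3 (t *: P) = `|t| * enorm3 P.
Proof.
rewrite /enorm3 -sqrtr_sqr -sqrtrM ?sqr_ge0//; congr Num.sqrt.
by rewrite /dot3/= /GRing.scale/=; ring.
Qed.

(** Cauchy-Schwarz, from Lagrange's identity. *)
Lemma le_dot3_enorm3 P Q : `|dot3 P Q| <= enorm3 P * enorm3 Q.
Proof.
rewrite -(ler_pXn2r (n := 2))// ?nnegrE ?mulr_ge0 ?enorm3_ge0//.
rewrite real_normK ?num_real// exprMn !sqr_enorm3.
rewrite -subr_ge0 (_ : _ - _ =
  (P.1.1 * Q.1.2 - P.1.2 * Q.1.1) ^+ 2 + (P.1.1 * Q.2 - P.2 * Q.1.1) ^+ 2 +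
  (P.1.2 * Q.2 - P.2 * Q.1.2) ^+ 2); last by rewrite /dot3; ring.
by rewrite !addr_ge0// sqr_ge0.
Qed.

Lemma ler_enorm3D P Q : enorm3 (P + Q) <= enorm3 P + enorm3 Q.
Proof.
rewrite -(ler_pXn2r (n := 2))// ?nnegrE ?addr_ge0 ?enorm3_ge0//.
rewrite sqrrD !sqr_enorm3.
have -> : dot3 (P + Q) (P + Q) = dot3 P P + dot3 P Q *+ 2 + dot3 Q Q.
  by rewrite /dot3/=; ring.
by rewrite lerD2r lerD2l lerMn2r (le_trans (ler_norm _) (le_dot3_enorm3 _ _)).
Qed.

Lemma norm_le_enorm3 P : `|P| <= enorm3 P.
Proof.
rewrite !prod_normE !ge_max -!sqrtr_sqr -andbA.
apply/and3P; split; rewrite ler_sqrt ?dot3_ge0// /dot3 -!expr2.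
- by rewrite -addrA lerDl addr_ge0// sqr_ge0.
- by rewrite addrAC lerDr addr_ge0// sqr_ge0.
- by rewrite lerDr addr_ge0// sqr_ge0.
Qed.

Lemma enorm3_eq0 P : (enorm3 P == 0) = (P == 0).
Proof.
apply/eqP/eqP => [P0|->]; last by rewrite /enorm3 /dot3/= !mulr0 !addr0 sqrtr0.
by apply/eqP; rewrite -normr_eq0 eq_le normr_ge0 andbT -P0 norm_le_enorm3.
Qed.

Lemma enorm3_gt0 P : (0 < enorm3 P) = (P != 0).
Proof. by rewrite lt_def enorm3_ge0 andbT enorm3_eq0. Qed.

Lemma dist3_gt0 P M : (0 < dist3 P M) = (P != M).
Proof. by rewrite /dist3 enorm3_gt0 subr_eq0. Qed.

Lemma dist3_self P : dist3 P P = 0.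
Proof. by apply/eqP; rewrite /dist3 subrr enorm3_eq0. Qed.

Lemma continuous_dot3 (T : topologicalType) (F : set_system T) {FF : Filter F}
    (f g : T -> R * R * R) P Q :
  f x @[x --> F] --> P -> g x @[x --> F] --> Q ->
  dot3 (f x) (g x) @[x --> F] --> dot3 P Q.
Proof.
move=> fP gQ.
have c1 (h : T -> R * R * R) M : h x @[x --> F] --> M -> (h x).1 @[x --> F] --> M.1.
  by move=> hM; apply: (cvg_comp _ _ hM); exact: cvg_fst.
have c2 (h : T -> R * R * R) M : h x @[x --> F] --> M -> (h x).2 @[x --> F] --> M.2.
  by move=> hM; apply: (cvg_comp _ _ hM); exact: cvg_snd.
have c11 (h : T -> R * R * R) M : h x @[x --> F] --> M -> (h x).1.1 @[x --> F] --> M.1.1.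
  by move=> /c1 hM; apply: (cvg_comp _ _ hM); exact: cvg_fst.
have c12 (h : T -> R * R * R) M : h x @[x --> F] --> M -> (h x).1.2 @[x --> F] --> M.1.2.
  by move=> /c1 hM; apply: (cvg_comp _ _ hM); exact: cvg_snd.
by apply: cvgD; [apply: cvgD|]; apply: cvgM; auto.
Qed.

Lemma cvg_enorm3 (T : topologicalType) (F : set_system T) {FF : Filter F}
    (f : T -> R * R * R) P :
  f x @[x --> F] --> P -> enorm3 (f x) @[x --> F] --> enorm3 P.
Proof.
move=> fP.
exact: (cvg_comp _ _ (continuous_dot3 fP fP) (@sqrt_continuous R _)).
Qed.

Lemma continuous_dist3 M : continuous (fun P => dist3 P M).
Proof.
move=> P; apply: cvg_enorm3; apply: cvgB; first exact: cvg_id.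
exact: cvg_cst.
Qed.

Lemma cvg_put k (T : topologicalType) (F : set_system T) {FF : Filter F}
    (f : T -> R * R) (g : T -> R) x t :
  f z @[z --> F] --> x -> g z @[z --> F] --> t ->
  put k (f z) (g z) @[z --> F] --> put k x t.
Proof.
move=> fx gt.
have f1 : (f z).1 @[z --> F] --> x.1 by apply: (cvg_comp _ _ fx); exact: cvg_fst.
have f2 : (f z).2 @[z --> F] --> x.2 by apply: (cvg_comp _ _ fx); exact: cvg_snd.
case: k => -[|[|[|//]]] ?.
- exact: (cvg_pair (cvg_pair gt f1) f2).
- exact: (cvg_pair (cvg_pair f1 gt) f2).
- exact: (cvg_pair (cvg_pair f1 f2) gt).
Qed.

Lemma continuous_drop_coord k : continuous (@drop_coord R k).
Proof.
move=> P.
have c1 : (fun Q : R * R * R => Q.1) @ P --> P.1 by exact: cvg_fst.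
have c2 : (fun Q : R * R * R => Q.2) @ P --> P.2 by exact: cvg_snd.
have c11 : (fun Q : R * R * R => Q.1.1) @ P --> P.1.1.
  by apply: (cvg_comp _ _ c1); exact: cvg_fst.
have c12 : (fun Q : R * R * R => Q.1.2) @ P --> P.1.2.
  by apply: (cvg_comp _ _ c1); exact: cvg_snd.
case: k => -[|[|[|//]]] ?.
- exact: (cvg_pair c12 c2).
- exact: (cvg_pair c11 c2).
- exact: (cvg_pair c11 c12).
Qed.

Local Notation mR := (measurableTypeR R).

Lemma measurable_put d (T : measurableType d) k (f : T -> mR * mR) (g : T -> mR) :
  measurable_fun setT f -> measurable_fun setT g ->
  measurable_fun setT (fun z => put k (f z) (g z) : mR * mR * mR).
Proof.
move=> mf mg.
have m1 : measurable_fun setT (fun z => (f z).1) by exact: measurableT_comp.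
have m2 : measurable_fun setT (fun z => (f z).2) by exact: measurableT_comp.
case: k => -[|[|[|//]]] ?; rewrite /put/=;
  by apply/measurable_fun_pairP; split => //=; apply/measurable_fun_pairP; split.
Qed.

Lemma boundary_closed (T : topologicalType) (A : set T) : closed (boundary A).
Proof. by apply: closedI; [exact: closed_closure|exact/open_closedC/open_interior]. Qed.

Lemma bounded_boundary_compact (A : set (R * R * R)) :
  bounded_set A -> compact (boundary A).
Proof.
move=> [B [Breal BA]].
pose b := `|B| + 1.
have Bb : B < b by rewrite /b ltr_pwDr// ler_norm.
have bnd P : A P -> `|P| <= b by move=> AP; exact: (BA b Bb).
pose I := [set x : R | x \in `[- b, b]].
have cI : compact I by exact: segment_compact.
have cK : compact ((I `*` I) `*` I) by do 2 apply: compact_setX => //.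
apply: (subclosed_compact (@boundary_closed _ A) cK).
apply: (@subset_trans _ (closure A)); first by move=> ? [].
rewrite closureE; apply: smallest_sub.
  have clI : closed I by exact: itv_closed.
  apply: compact_closed; first exact: norm_hausdorff.
  exact: cK.
move=> P /bnd; rewrite !prod_normE !ge_max => /andP[/andP[h1 h2] h3].
by split; [split|]; rewrite /I/= in_itv/= -ler_norml.
Qed.

End coordinates.

(** * First order expansion of a chart *)

Section holder_charts.
Context (R : realType).
Implicit Types (x y : R * R) (V : set (R * R)) (f g : R * R -> R) (alpha : R).

Definition enorm2 y : R := Num.sqrt (y.1 ^+ 2 + y.2 ^+ 2).

Lemma enorm2_ge0 y : 0 <= enorm2 y. Proof. exact: sqrtr_ge0. Qed.

Lemma sqr_enorm2 y : enorm2 y ^+ 2 = y.1 ^+ 2 + y.2 ^+ 2.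
Proof. by rewrite sqr_sqrtr// addr_ge0// sqr_ge0. Qed.

Lemma norm1_le_enorm2 y : `|y.1| <= enorm2 y.
Proof. by rewrite -sqrtr_sqr ler_sqrt ?addr_ge0 ?sqr_ge0// lerDl sqr_ge0. Qed.

Lemma norm2_le_enorm2 y : `|y.2| <= enorm2 y.
Proof. by rewrite -sqrtr_sqr ler_sqrt ?addr_ge0 ?sqr_ge0// lerDr sqr_ge0. Qed.

Lemma norm_le_enorm2 y : `|y| <= enorm2 y.
Proof. by rewrite prod_normE ge_max norm1_le_enorm2 norm2_le_enorm2. Qed.

Lemma enorm2_eq0 y : (enorm2 y == 0) = (y == 0).
Proof.
apply/eqP/eqP => [y0|->]; last by rewrite /enorm2/= expr0n/= addr0 sqrtr0.
by apply/eqP; rewrite -normr_eq0 eq_le normr_ge0 andbT -y0 norm_le_enorm2.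
Qed.

Lemma enorm2_gt0 y : (0 < enorm2 y) = (y != 0).
Proof. by rewrite lt_def enorm2_ge0 andbT enorm2_eq0. Qed.

Lemma holder_continuous alpha V g x : 0 < alpha -> open V ->
  holder_on alpha V g -> V x -> {for x, continuous g}.
Proof.
move=> a0 oV [C HC] Vx; apply/cvgrPdist_lt => e e0.
pose D := `|C| + 1; have D0 : 0 < D by rewrite ltr_wpDl.
have eD : 0 < e / D by rewrite divr_gt0.
have d0 : 0 < (e / D) `^ alpha^-1 by rewrite powR_gt0.
near=> y.
have Vy : V y by near: y; exact: (open_nbhs_nbhs (conj oV Vx)).
have : `|x - y| < (e / D) `^ alpha^-1 by near: y; exact: cvgr_dist_lt.
move=> /(gt0_ltr_powR a0) => /(_ (normr_ge0 _) (powR_ge0 _ _)).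
rewrite -powRrM mulVf ?gt_eqF// powRr1 ?(ltW eD)// ltr_pdivlMr// => h.
apply: le_lt_trans (HC _ _ Vx Vy) (le_lt_trans _ h).
rewrite mulrC ler_wpM2l ?powR_ge0// /D (le_trans (ler_norm C))// lerDl//.
Unshelve. all: by end_near. Qed.

Lemma derive_partials f x y : differentiable f x ->
  'D_y f x = y.1 * partial1 f x + y.2 * partial2 f x.
Proof.
move=> df; rewrite /partial1 /partial2 !deriveE//.
have {1}-> : y = y.1 *: (1, 0) + y.2 *: (0, 1) :> R * R.
  case: y => a b; transitivity (a * 1 + b * 0, a * 0 + b * 1) => //.
  by rewrite !mulr1 !mulr0 addr0 add0r.
by rewrite linearD !linearZ.
Qed.

(** The mean value theorem along the segment from [x0] to [x] bounds the error of
    the first order expansion by the oscillation of the gradient. *)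
Lemma holder_taylor alpha V f : 0 < alpha -> C1_holder_on alpha V f ->
  exists2 C, 0 <= C & forall x0 (r : R) x, ball x0 r `<=` V -> ball x0 r x ->
    `|f x - f x0 - ((x - x0).1 * partial1 f x0 + (x - x0).2 * partial2 f x0)| <=
    C * enorm2 (x - x0) `^ (1 + alpha).
Proof.
move=> a0 [df [C1 H1] [C2 H2]].
exists (`|C1| + `|C2|); first by rewrite addr_ge0.
move=> x0 r x bV; rewrite -ball_normE/= => xr.
pose y := x - x0.
have Vs (s : R) : 0 <= s <= 1 -> V (x0 + s *: y).
  move=> /andP[s0 s1]; apply: bV; rewrite -ball_normE/= opprD addNKr normrN normrZ.
  rewrite ger0_norm// (le_lt_trans _ xr)// distrC.
  by rewrite -[leRHS]mul1r ler_wpM2r.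
pose g (s : R) := f (x0 + s *: y).
have dg (s : R) : 0 <= s <= 1 ->
    is_derive s 1 g (y.1 * partial1 f (x0 + s *: y) + y.2 * partial2 f (x0 + s *: y)).
  move=> s01; have dfs := df _ (Vs s s01).
  rewrite -derive_partials; last exact: dfs.
  have E : (fun h : R => h^-1 *: ((g \o shift s) (h *: 1) - g s)) =
           (fun h : R => h^-1 *: ((f \o shift (x0 + s *: y)) (h *: y) - f (x0 + s *: y))).
    apply/funext => h /=; rewrite /g/=; congr (_ *: (f _ - _)).
    by rewrite -[h *: 1]/(h * 1) mulr1 scalerDl addrCA.
  apply: DeriveDef; first by rewrite /derivable E; exact: diff_derivable.
  by rewrite /derive E.
have dg' (s : R) : s \in `]0, 1[ -> is_derive s 1 g
    (y.1 * partial1 f (x0 + s *: y) + y.2 * partial2 f (x0 + s *: y)).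
  by move=> s01; apply: dg; move: s01; rewrite in_itv/= => /andP[/ltW -> /ltW ->].
have [|c] := MVT ltr01 dg'.
  apply: derivable_within_continuous => s; rewrite in_itv/= => s01.
  by have [] := dg s s01.
rewrite in_itv/= subr0 mulr1 => c01.
have {}c01 : 0 <= c <= 1 by case/andP: c01 => /ltW -> /ltW ->.
rewrite /g scale1r scale0r addr0 /y subrKC -/y => ->.
have Vx0 : V x0 by move: (Vs 0); rewrite scale0r addr0 lexx ler01; exact.
set z := x0 + c *: y.
have zx0 : `|z - x0| `^ alpha <= enorm2 y `^ alpha.
  apply: ge0_ler_powR; rewrite ?nnegrE ?enorm2_ge0 ?(ltW a0)//.
  rewrite /z addrAC subrr add0r normrZ; case/andP: c01 => c0 c1.
  rewrite ger0_norm// (le_trans _ (norm_le_enorm2 y))//.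
  by rewrite -[leRHS]mul1r ler_wpM2r.
have h1 : `|partial1 f z - partial1 f x0| <= `|C1| * enorm2 y `^ alpha.
  apply: le_trans (H1 _ _ (Vs _ c01) Vx0) _.
  apply: (@le_trans _ _ (`|C1| * `|z - x0| `^ alpha)).
    by rewrite ler_wpM2r ?powR_ge0// ler_norm.
  by rewrite ler_wpM2l.
have h2 : `|partial2 f z - partial2 f x0| <= `|C2| * enorm2 y `^ alpha.
  apply: le_trans (H2 _ _ (Vs _ c01) Vx0) _.
  apply: (@le_trans _ _ (`|C2| * `|z - x0| `^ alpha)).
    by rewrite ler_wpM2r ?powR_ge0// ler_norm.
  by rewrite ler_wpM2l.
have -> : y.1 * partial1 f z + y.2 * partial2 f z -
    (y.1 * partial1 f x0 + y.2 * partial2 f x0) =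
    y.1 * (partial1 f z - partial1 f x0) + y.2 * (partial2 f z - partial2 f x0).
  by ring.
apply: le_trans (ler_normD _ _) _; rewrite !normrM.
rewrite powRD; last by rewrite gt_eqF// addr_gt0.
rewrite powRr1 ?enorm2_ge0// mulrCA mulrDl mulrDr.
by apply: lerD; apply: ler_pM; rewrite ?norm1_le_enorm2 ?norm2_le_enorm2.
Qed.

End holder_charts.

(** * Surface integrals in a chart *)

Section surface_patches.
Context (R : realType) (alpha : R) (Omega : set (R * R * R)).
Local Notation mR := (measurableTypeR R).
Local Notation R2 := (mR * mR)%type.
Local Notation R3 := (mR * mR * mR)%type.
Local Notation leb2 := (@lebesgue_measure R \x @lebesgue_measure R)%E.
Variable sigma : {measure set R3 -> \bar R}.
Hypotheses (alpha0 : 0 < alpha) (sigmaS : surface_measure alpha Omega sigma).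

Definition area_element (f : R * R -> R) (x : R * R) : R :=
  Num.sqrt (1 + partial1 f x ^+ 2 + partial2 f x ^+ 2).

Lemma area_element_ge0 f x : 0 <= area_element f x.
Proof. exact: sqrtr_ge0. Qed.

(** The part of the surface over [B], cut out by an open set of space so that it
    can be used in coverings. *)
Definition surface_patch k (W : set (R * R * R)) (B : set (R * R)) : set (R * R * R) :=
  boundary Omega `&` (W `&` drop_coord k @^-1` B).

Section chart.
Variables (k : 'I_3) (V : set (R * R)) (W : set (R * R * R)) (f : R * R -> R).
Hypothesis ch : graph_chart alpha Omega k V W f.

Let oV : open V. Proof. by case: ch => -[]. Qed.
Let oW : open W. Proof. by case: ch => -[]. Qed.
Let bdW : boundary Omega `&` W = [set put k x (f x) | x in V].
Proof. by case: ch. Qed.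

Lemma chart_eq Q : boundary Omega Q -> W Q ->
  V (drop_coord k Q) /\ Q = put k (drop_coord k Q) (f (drop_coord k Q)).
Proof.
move=> bQ WQ; have : (boundary Omega `&` W) Q by [].
by rewrite bdW => -[x Vx <-]; rewrite drop_coord_put.
Qed.

Lemma chart_mem x : V x -> (boundary Omega `&` W) (put k x (f x)).
Proof. by move=> Vx; rewrite bdW; exists x. Qed.

Lemma chart_continuous x : V x -> {for x, continuous f}.
Proof.
by move=> Vx; case: ch => _ [df _ _] _ _; exact/differentiable_continuous/df.
Qed.

Lemma chart_partial1_continuous x : V x -> {for x, continuous (partial1 f)}.
Proof. by case: ch => _ [_ h _] _ _; exact: holder_continuous h. Qed.

Lemma chart_partial2_continuous x : V x -> {for x, continuous (partial2 f)}.
Proof. by case: ch => _ [_ _ h] _ _; exact: holder_continuous h. Qed.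

Lemma chart_area_continuous x : V x -> {for x, continuous (area_element f)}.
Proof.
move=> Vx.
have c1 := chart_partial1_continuous Vx; have c2 := chart_partial2_continuous Vx.
have h : (1 + partial1 f z ^+ 2 + partial2 f z ^+ 2) @[z --> x] -->
    1 + partial1 f x ^+ 2 + partial2 f x ^+ 2.
  apply: cvgD; first (apply: cvgD; first exact: cvg_cst).
    exact: (cvg_comp _ _ c1 (@exprn_continuous R 2 _)).
  exact: (cvg_comp _ _ c2 (@exprn_continuous R 2 _)).
exact: (cvg_comp _ _ h (@sqrt_continuous R _)).
Qed.

Lemma open_patch (B : set (R * R)) : open B -> open (W `&` drop_coord k @^-1` B).
Proof.
move=> oB; apply: openI => //.
by have /continuousP cd := @continuous_drop_coord R k; exact: cd.
Qed.

Lemma measurable_boundary : measurable (boundary Omega : set R3).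
Proof. by apply: closed_measurable_R3; exact: boundary_closed. Qed.

Lemma measurable_patch (B : set (R * R)) : open B ->
  measurable (surface_patch k W B : set R3).
Proof.
move=> oB; apply: measurableI; first exact: measurable_boundary.
by apply: open_measurable_R3; exact: open_patch.
Qed.

Section transfer.
Variable B : set (R * R).
Hypotheses (oB : open B) (BV : B `<=` V).

Let mB : measurable (B : set R2). Proof. exact: open_measurable_R2. Qed.

Lemma patch_mem x : B x -> surface_patch k W B (put k x (f x)).
Proof.
move=> Bx; have [bd Wx] := chart_mem (BV Bx).
by split => //; split => //=; rewrite drop_coord_put.
Qed.

Lemma measurable_chart (g : R * R -> R) :
  (forall x, V x -> {for x, continuous g}) ->
  measurable_fun (B : set R2) (g : _ -> mR).
Proof.
move=> cg; apply: continuous_measurable_R2 => //.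
by apply: continuous_in_subspaceT => x; rewrite inE => /BV; exact: cg.
Qed.

(** The chart is only controlled over [B]; extending [f] by zero makes the
    parametrization measurable on the whole plane. *)
Lemma measurable_comp_chart d (T : measurableType d) (h : R3 -> T) :
  measurable_fun setT h ->
  measurable_fun (B : set R2) (fun x => h (put k x (f x))).
Proof.
move=> mh; pose phi (x : R2) : R3 := put k x ((f \_ B) x).
have mphi : measurable_fun setT phi.
  apply: measurable_put => //.
  apply: (measurable_restrictT _ mB).1; apply: measurable_chart.
  exact: chart_continuous.
apply: (eq_measurable_fun (h \o phi)).
  by move=> x xB; rewrite /phi/= patchE xB.
by apply: measurable_funTS; exact: measurableT_comp.
Qed.

(** The defining property of the surface measure, from sets to functions. *)
Lemma ge0_integral_patch (h : R3 -> \bar R) :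
  measurable_fun (surface_patch k W B) h -> (forall P, surface_patch k W B P -> 0 <= h P)%E ->
  (\int[sigma]_(P in surface_patch k W B) h P =
   \int[leb2]_(x in B) (h (put k x (f x)) * (area_element f x)%:E))%E.
Proof.
move=> mh h0.
pose phi (x : R2) : R3 := put k x ((f \_ B) x).
pose J : R * R -> R := area_element f \_ B.
have mphi : measurable_fun setT phi.
  apply: measurable_put => //.
  apply: (measurable_restrictT _ mB).1; apply: measurable_chart.
  exact: chart_continuous.
have mJ : measurable_fun [set: R2] (J : _ -> mR).
  apply: (measurable_restrictT _ mB).1; apply: measurable_chart.
  exact: chart_area_continuous.
have J0 x : 0 <= J x.
  by rewrite /J patchE; case: ifP => // _; exact: area_element_ge0.
have phiB x : B x -> phi x = put k x (f x).
  by move=> Bx; rewrite /phi patchE mem_set.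
have mD := measurable_patch oB.
have nuE (A : set R3) : measurable A -> A `<=` surface_patch k W B ->
    (sigma A = \int[leb2]_(x in phi @^-1` A) (J x)%:E)%E.
  move=> mA AD; have [_ sE] := sigmaS.
  rewrite (sE _ _ _ _ ch)//; last by move=> P /AD [? [? ?]].
  rewrite integral_mkcond [RHS]integral_mkcond; apply: eq_integral => x _.
  rewrite !patchE /J patchE.
  have [Bx|nBx] := pselect (B x).
    rewrite (mem_set Bx); congr (if _ then _ else _).
    apply/idP/idP; rewrite !inE /preimage /= phiB//.
      by case.
    by split => //; exact: BV.
  rewrite (memNset nBx) memNset; first by case: ifP.
  move=> [Vx Ax]; apply: nBx; have [_ [_ /=]] := AD _ Ax.
  by rewrite drop_coord_put.
rewrite (ge0_integral_density_pushforward mphi mJ J0 mD nuE mh h0).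
rewrite integral_mkcond [RHS]integral_mkcond; apply: eq_integral => x _.
rewrite !patchE /J patchE.
have [Bx|nBx] := pselect (B x).
  rewrite (mem_set Bx) mem_set ?phiB//.
  by rewrite /preimage /= phiB//; exact: patch_mem.
by rewrite (memNset nBx) mule0; case: ifP.
Qed.

End transfer.

End chart.

End surface_patches.

(** * Local integrability on a compact set *)

Section local_integrability.
Context (R : realType).
Local Notation mR := (measurableTypeR R).
Local Notation R3 := (mR * mR * mR)%type.

Lemma compact_integral_lty (sigma : {measure set R3 -> \bar R})
    (K : set (R * R * R)) (h : R3 -> \bar R) :
  compact K -> measurable (K : set R3) ->
  measurable_fun (K : set R3) h -> (forall P, K P -> 0 <= h P)%E ->
  (forall Q, K Q -> exists U : set (R * R * R),
    [/\ open U, U Q & (\int[sigma]_(P in K `&` U) h P < +oo)%E]) ->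
  (\int[sigma]_(P in K) h P < +oo)%E.
Proof.
move=> cK mK mh h0 loc.
have loc' Q : exists U : set (R * R * R), (K Q -> U Q) /\
    (open U /\ (\int[sigma]_(P in K `&` U) h P < +oo)%E).
  have [KQ|nKQ] := pselect (K Q).
    by have [U [oU UQ iU]] := loc _ KQ; exists U.
  by exists set0; split => //; rewrite setI0 integral_set0; split => //; exact: open0.
have [U HU] := choice loc'.
have fin (s : seq (R * R * R)) :
    measurable (K `&` [set P | exists2 Q, Q \in s & U Q P] : set R3) /\
    (\int[sigma]_(P in K `&` [set P | exists2 Q, Q \in s & U Q P]) h P < +oo)%E.
  elim: s => [|a s [mS iS]].
    rewrite (_ : [set P | _] = set0) ?setI0; last first.
      by apply/seteqP; split => // P [].
    by rewrite integral_set0; split => //; exact: measurable0.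
  have [_ [oa ia]] := HU a.
  set S := K `&` _ in mS iS.
  have -> : K `&` [set P | exists2 Q, Q \in a :: s & U Q P] = (K `&` U a) `|` (S `\` (K `&` U a)).
    rewrite setUDr setDv setD0; apply/seteqP; split=> [P [KP [Q + UQ]]|P].
      rewrite inE => /predU1P[Qa|Qs]; first by left; rewrite -Qa.
      by right; split => //; exists Q.
    move=> [[KP UP]|[KP [Q Qs UQ]]]; split => //.
      by exists a; rewrite ?mem_head.
    by exists Q => //; rewrite inE Qs orbT.
  have ma : measurable (K `&` U a : set R3).
    by apply: measurableI => //; exact: open_measurable_R3.
  have mSa : measurable (S `\` (K `&` U a) : set R3) by exact: measurableD.
  split; first exact: measurableU.
  rewrite ge0_integral_setU//.
  - apply: lte_add_pinfty => //; apply: le_lt_trans iS.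
    apply: ge0_subset_integral => //.
    + by apply: measurable_funS mh => // P [].
    + by move=> P [KP _]; exact: h0.
  - by apply: measurable_funS mh => // P [[]|[[]]].
  - by move=> P [[KP _]|[[KP _] _]]; exact: h0.
  - by apply/disj_setPS => P [PA [_ nPA]].
(* Finite sets of points, directed by inclusion, index the finite subcovers. *)
pose F (S : set (seq (R * R * R))) := exists s0 : seq (R * R * R),
  forall s : seq (R * R * R), {subset s0 <= s} -> S s.
have FF : Filter F.
  split => [|S S' [s sS] [s' sS']|S S' SS' [s sS]]; first by exists [::].
    exists (s ++ s') => r sr; split; [apply: sS|apply: sS'] => Q Qs;
      by apply: sr; rewrite mem_cat Qs ?orbT.
  by exists s => r /sS; exact: SS'.
have /compact_near_coveringP cov := cK.
have [|s /(_ s (fun _ => id)) Ks] :=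
    cov _ F (fun s P => exists2 Q, Q \in s & U Q P) FF.
  move=> Q KQ; have [/(_ KQ) UQ [oU _]] := HU Q.
  exists (U Q, [set s : seq (R * R * R) | Q \in s]); first split => /=.
  - exact: (open_nbhs_nbhs (conj oU UQ)).
  - by exists [:: Q] => s; apply; rewrite inE.
  - by move=> [P s] /= [UP Qs]; exists Q.
have [_] := fin s.
by rewrite setIidl.
Qed.

End local_integrability.

(** * Weakly singular surface integrals *)

Section weak_singularities.
Context (R : realType).
Local Notation mR := (measurableTypeR R).
Local Notation R2 := (mR * mR)%type.
Local Notation R3 := (mR * mR * mR)%type.
Local Notation leb2 := (@lebesgue_measure R \x @lebesgue_measure R)%E.

Lemma measurable_enorm2 (c : R * R) :
  measurable_fun [set: R2] (fun x : R * R => enorm2 (x - c) : mR).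
Proof.
apply: (measurableT_comp (@measurable_sqrtr R)).
by apply: measurable_funD; apply: measurable_funX; apply: measurable_funB.
Qed.

Lemma integral_enorm2_powR_ball_lty (c : R * R) (b r : R) : 0 < b -> 0 < r ->
  (\int[leb2]_(x in ball c r) (enorm2 (x - c) `^ (b - 2))%:E < +oo)%E.
Proof.
move=> b0 r0.
pose F (z : R * R) : R := if z.1 ^+ 2 + z.2 ^+ 2 < (2 * r) ^+ 2
  then Num.sqrt (z.1 ^+ 2 + z.2 ^+ 2) `^ (b - 2) else 0.
have F0 z : 0 <= F z by rewrite /F; case: ifP => // _; exact: powR_ge0.
have m2 : measurable_fun [set: R2] (fun z : R2 => z.1 ^+ 2 + z.2 ^+ 2 : mR).
  by apply: measurable_funD; apply: measurable_funX.
have mp : measurable_fun [set: mR] (fun x : mR => x `^ (b - 2) : mR).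
  exact: measurable_powR.
have mF : measurable_fun [set: R2] (F : _ -> mR).
  apply: measurable_fun_if => //; first exact: measurable_fun_ltr.
  apply: measurable_funTS; apply: (measurableT_comp mp).
  exact: (measurableT_comp (@measurable_sqrtr R)).
have mA : measurable_fun [set: R2]
    (fun z : R2 => ((1 * z.1 + 0 * z.2 - c.1)%R, (1 * z.2 - c.2)%R) : R2).
  apply/measurable_fun_pairP; split => /=.
    apply: measurable_funB => //; apply: measurable_funD => //;
    exact: measurable_funM.
  by apply: measurable_funB => //; exact: measurable_funM.
apply: (@le_lt_trans _ _ (\int[leb2]_z (F z)%:E)%E); last first.
  by apply: integral_powR_disc_lty => //; rewrite mulr_gt0.
have := @ge0_integral_triangular R 1 0 1 (- c.1) (- c.2) (EFin \o F) ltr01 ltr01.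
rewrite mulr1 invr1 mul1e => <-; last 2 first.
- exact/measurable_EFinP.
- by move=> z; rewrite lee_fin.
have mB : measurable (ball c r : set R2) by apply: open_measurable_R2; exact: ball_open.
rewrite integral_mkcond; apply: ge0_le_integral => //.
- by move=> z _; rewrite patchE; case: ifP => // _; rewrite lee_fin powR_ge0.
- apply: (measurable_restrictT _ mB).1.
  apply/measurable_EFinP; apply: measurable_funTS.
  exact: (measurableT_comp mp (measurable_enorm2 c)).
- by apply/measurable_EFinP; exact: (measurableT_comp mF mA).
move=> z _; rewrite patchE; case: ifPn => [|_]; last by rewrite lee_fin.
rewrite inE -ball_normE/= distrC => zr; rewrite lee_fin /F/= !mul1r mul0r addr0.
case: ifPn => //; rewrite -leNgt => /negP[]; apply/negP; rewrite -ltNge.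
have h1 : `|z.1 - c.1| < r.
  by apply: le_lt_trans zr; rewrite prod_normE le_max lexx.
have h2 : `|z.2 - c.2| < r.
  by apply: le_lt_trans zr; rewrite prod_normE le_max lexx orbT.
have sq (x : R) : `|x| < r -> x ^+ 2 < r ^+ 2.
  by move=> xr; rewrite -real_normK ?num_real// ltr_pXn2r ?nnegrE// ltW.
have := sq _ h1; have := sq _ h2.
have : 0 < r ^+ 2 by rewrite exprn_gt0.
nra.
Qed.

Lemma measure_ball_lty (c : R * R) (r : R) : (leb2 (ball c r) < +oo)%E.
Proof.
have -> : ball c r = ball c.1 r `*` ball c.2 r by [].
have mb (a : R) : measurable (ball a r : set mR).
  by apply: open_measurable; exact: ball_open.
have fin (a : R) : (@lebesgue_measure R (ball a r) < +oo)%E.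
  have [r0|r0] := ltP 0 r; last by rewrite (ball0 a r).2// measure0.
  by rewrite lebesgue_measure_ball ?ltry// ltW.
rewrite product_measure1E//; apply: lte_mul_pinfty => //; last exact: fin.
by rewrite ge0_fin_numE//; exact: fin.
Qed.

Lemma ler_powR_neg (p a b : R) : p <= 0 -> 0 < a -> a <= b -> b `^ p <= a `^ p.
Proof.
move=> p0 a0 ab; rewrite -[p]opprK [leLHS]powRN [leRHS]powRN.
rewrite lef_pV2 ?posrE ?powR_gt0//; last exact: lt_le_trans ab.
by apply: ge0_ler_powR; rewrite ?oppr_ge0// nnegrE ltW// (lt_le_trans a0).
Qed.

Context (alpha : R) (Omega : set (R * R * R)).
Variable sigma : {measure set R3 -> \bar R}.
Hypotheses (alpha0 : 0 < alpha) (Omega_bounded : bounded_set Omega).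
Hypotheses (OmegaC : boundary_C1_holder alpha Omega).
Hypothesis (sigmaS : surface_measure alpha Omega sigma).

Lemma chart_ball k V W f Q : graph_chart alpha Omega k V W f ->
  boundary Omega Q -> W Q ->
  exists2 r : R, 0 < r & ball (drop_coord k Q) r `<=`
    [set x | V x /\ area_element f x <= area_element f (drop_coord k Q) + 1].
Proof.
move=> ch bQ WQ; have [Vx0 _] := chart_eq ch bQ WQ.
have oV : open V by case: ch => -[].
have : \forall x \near drop_coord k Q,
    V x /\ area_element f x <= area_element f (drop_coord k Q) + 1.
  near=> x; split; first by near: x; exact: (open_nbhs_nbhs (conj oV Vx0)).
  have : `|area_element f (drop_coord k Q) - area_element f x| < 1.
    by near: x; apply: cvgr_dist_lt => //; exact: (chart_area_continuous alpha0 ch Vx0).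
  by rewrite ltr_distlC => /andP[_ /ltW].
by move=> /nbhs_ballP[r /= r0 hr]; exists r.
Unshelve. all: by end_near. Qed.

Lemma dist3_put_ge k x y s t : enorm2 (x - y) <= @dist3 R (put k x s) (put k y t).
Proof.
rewrite /dist3 putB /enorm3 dot3_put -!expr2 ler_sqrt.
  by rewrite lerDl sqr_ge0.
by rewrite !addr_ge0// sqr_ge0.
Qed.

Lemma measurable_dist3 M : measurable_fun [set: R3] (fun P => dist3 P M : mR).
Proof.
apply: continuous_measurable_R3; first exact: measurableT.
by apply: continuous_subspaceT; exact: continuous_dist3.
Qed.

(** Projecting to the plane of the chart does not increase distances, so near [M]
    the integrand is dominated by a power that is integrable in the plane; away
    from [M] it is bounded. The exponent [b = 2] gives the finiteness of the
    area. *)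
Lemma integral_dist3_powR_lty (M : R * R * R) (b : R) : 0 < b <= 2 ->
  (\int[sigma]_(P in boundary Omega) (dist3 P M `^ (b - 2))%:E < +oo)%E.
Proof.
move=> /andP[b0 b2].
have mp : measurable_fun [set: mR] (fun x : mR => x `^ (b - 2) : mR).
  exact: measurable_powR.
have mh : measurable_fun [set: R3] (fun P => (dist3 P M `^ (b - 2))%:E).
  by apply/measurable_EFinP; exact: (measurableT_comp mp (measurable_dist3 M)).
apply: compact_integral_lty.
- exact: bounded_boundary_compact.
- exact: measurable_boundary.
- exact: measurable_funTS.
- by move=> P _; rewrite lee_fin powR_ge0.
move=> Q bQ; have [k [V [W [f [ch WQ]]]]] := OmegaC bQ.
have [r r0 hr] := chart_ball ch bQ WQ.
have [Vx0 QE] := chart_eq ch bQ WQ.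
set x0 := drop_coord k Q in hr Vx0 QE.
have oB : open (ball x0 r) by exact: ball_open.
have BV : ball x0 r `<=` V by move=> x /hr[].
have mB : measurable (ball x0 r : set R2) by exact: open_measurable_R2.
have oP := open_patch ch oB.
have mP := measurable_patch ch oB.
have PQ : (W `&` drop_coord k @^-1` ball x0 r) Q.
  by split => //=; exact: ballxx.
pose Jm := area_element f x0 + 1.
have Jm0 : 0 <= Jm by rewrite addr_ge0// area_element_ge0.
have mJ : measurable_fun (ball x0 r : set R2) (fun x => (area_element f x)%:E).
  apply/measurable_EFinP; apply: (measurable_chart oB BV).
  exact: (chart_area_continuous alpha0 ch).
(* A bound in the coordinates of the chart suffices, the area element being
   bounded by [Jm]; [D] may be smaller than the whole patch. *)
have bound (h : R3 -> \bar R) (g : R * R -> R) (D : set R3) :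
    measurable D -> D `<=` surface_patch Omega k W (ball x0 r) ->
    measurable_fun [set: R3] h -> (forall P, 0 <= h P)%E ->
    measurable_fun [set: R2] (g : _ -> mR) -> (forall x, 0 <= g x) ->
    (forall x, ball x0 r x -> D (put k x (f x)) -> h (put k x (f x)) <= (g x)%:E)%E ->
    (\int[leb2]_(x in ball x0 r) (g x)%:E < +oo)%E ->
    (\int[sigma]_(P in D) h P < +oo)%E.
  move=> mD DP mhh hh0 mg g0 hg ig.
  have mhD : measurable_fun [set: R3] (h \_ D).
    by apply: (measurable_restrictT _ mD).1; exact: measurable_funTS.
  have hD0 P : (0 <= (h \_ D) P)%E by rewrite patchE; case: ifP.
  apply: (@le_lt_trans _ _ (\int[sigma]_(P in surface_patch Omega k W (ball x0 r)) (h \_ D) P)%E).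
    by rewrite -integral_mkcondr setIidr.
  rewrite (ge0_integral_patch alpha0 sigmaS ch oB BV)//; last exact: measurable_funTS.
  apply: (@le_lt_trans _ _ (\int[leb2]_(x in ball x0 r) (Jm%:E * (g x)%:E))%E).
    apply: ge0_le_integral => //.
    + by move=> x _; rewrite mule_ge0 ?lee_fin ?area_element_ge0.
    + apply: emeasurable_funM => //.
      exact: (measurable_comp_chart ch oB BV).
    + by apply: emeasurable_funM => //; apply/measurable_EFinP; exact: measurable_funTS.
    + move=> x Bx; rewrite muleC; apply: lee_pmul; rewrite ?lee_fin ?area_element_ge0//.
        by have [] := hr _ Bx.
      rewrite patchE; case: ifPn => [|_]; last by rewrite lee_fin.
      by rewrite inE => Dx; exact: hg.
  rewrite ge0_integralZl//.
  + by apply: lte_mul_pinfty; rewrite ?lee_fin.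
  + by apply/measurable_EFinP; exact: measurable_funTS.
  + by move=> x _; rewrite lee_fin.
have [QM|QM] := eqVneq Q M.
- exists (W `&` drop_coord k @^-1` ball x0 r); split => //.
  apply: (bound _ (fun x => enorm2 (x - x0) `^ (b - 2))) => //.
  + by move=> P; rewrite lee_fin powR_ge0.
  + exact: (measurableT_comp mp (measurable_enorm2 x0)).
  + by move=> x; exact: powR_ge0.
  + move=> x Bx _; rewrite lee_fin -QM QE.
    have [->|xx0] := eqVneq x x0.
      by rewrite dist3_self subrr (eqP (_ : enorm2 (0 : R * R) == 0)) ?enorm2_eq0.
    apply: ler_powR_neg; first by rewrite subr_le0.
      by rewrite enorm2_gt0 subr_eq0.
    exact: dist3_put_ge.
  + exact: integral_enorm2_powR_ball_lty.
- have d0 : 0 < dist3 Q M by rewrite dist3_gt0.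
  pose U := [set P | dist3 Q M / 2 < dist3 P M].
  have oU : open U.
    have /continuousP := @continuous_dist3 R M.
    by move=> cd; exact: (cd _ (@open_gt R (dist3 Q M / 2))).
  exists (W `&` drop_coord k @^-1` ball x0 r `&` U); split.
  + exact: openI.
  + by split => //; rewrite /U/= gtr_pMr// invf_lt1// ltr1n.
  rewrite setIA; apply: (bound _ (fun=> (dist3 Q M / 2) `^ (b - 2))) => //.
  + by apply: measurableI => //; exact: open_measurable_R3.
  + by move=> P; rewrite lee_fin powR_ge0.
  + by move=> x; exact: powR_ge0.
  + move=> x Bx [_ Ux]; rewrite lee_fin; apply: ler_powR_neg.
    * by rewrite subr_le0.
    * by rewrite divr_gt0.
    * exact: ltW.
  + rewrite integral_cst//; apply: lte_mul_pinfty; rewrite ?lee_fin ?powR_ge0//.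
    exact: measure_ball_lty.
Qed.

End weak_singularities.

(** * Dominated convergence at the right of zero *)

Section dominated_convergence_at_right.
Context d (T : measurableType d) (R : realType).
Variables (mu : {measure set T -> \bar R}) (D : set T) (mD : measurable D).

Lemma dominated_cvg_at_right (q : R -> T -> R) (l g : T -> R) (t0 : R) :
  0 < t0 ->
  (forall t, 0 < t -> measurable_fun D (q t)) -> measurable_fun D l ->
  mu.-integrable D (EFin \o g) ->
  (forall x, D x -> q t x @[t --> 0^'+] --> l x) ->
  (forall t x, 0 < t < t0 -> D x -> `|q t x| <= g x) ->
  mu.-integrable D (EFin \o l) /\
  (\int[mu]_(x in D) q t x) @[t --> 0^'+] --> \int[mu]_(x in D) l x.
Proof.
move=> t00 mq ml ig ql qg.
have seq_dct (u : R^nat) : (forall n, 0 < u n < t0) -> u n @[n --> \oo] --> 0 ->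
    mu.-integrable D (EFin \o l) /\
    (\int[mu]_(x in D) q (u n) x) @[n --> \oo] --> \int[mu]_(x in D) l x.
  move=> ut u0.
  have [|||||il _ cv] := @dominated_convergence _ _ _ mu D mD
    (fun n x => (q (u n) x)%:E) (EFin \o l) (EFin \o g).
  - by move=> n; apply/measurable_EFinP; apply: mq; have /andP[] := ut n.
  - exact/measurable_EFinP.
  - apply: aeW => x Dx; apply: cvg_EFin; first exact: nearW.
    have /cvg_at_rightP := ql x Dx; apply; split => // n.
    by have /andP[] := ut n.
  - exact: ig.
  - by apply: aeW => x n Dx; rewrite /= lee_fin qg.
  split => //; apply: fine_cvg; rewrite fineK; last exact: integrable_fin_num.
  exact: cv.
split.
  have [] // := seq_dct (fun n => t0 / 2 / n.+1%:R).
    move=> n; rewrite !divr_gt0//= ltr_pdivrMr//.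
    apply: (@lt_le_trans _ _ t0); first by rewrite ltr_pdivrMr// ltr_pMr// ltr1n.
    by rewrite ler_pMr// ler1n.
  rewrite -[X in _ --> X](mulr0 (t0 / 2)); apply: cvgM; first exact: cvg_cst.
  exact: cvg_harmonic.
apply/cvg_at_rightP => u [u0 uc].
have [N _ HN] : \forall n \near \oo, u n < t0 by apply: cvgr_lt uc _ _.
rewrite -(cvg_shiftn N); apply: (seq_dct (fun n => u (n + N)%N) _ _).2.
  by move=> n; rewrite u0/=; apply: HN; rewrite /= leq_addl.
by rewrite (cvg_shiftn N).
Qed.

End dominated_convergence_at_right.

(** * The difference quotient of the Newtonian kernel *)

Section difference_quotient.
Context (R : realType).
Implicit Types (P Q n : R * R * R) (t : R).

Definition quotient_den P Q n t : R :=
  dist3 P Q * dist3 P (Q + t *: n) * (dist3 P Q + dist3 P (Q + t *: n)).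

Definition slope_part P Q n t : R := 2 * dot3 (P - Q) n / quotient_den P Q n t.

Definition jump_part P Q n t : R := t / quotient_den P Q n t.

Lemma sqr_dist3_shift P Q n t : enorm3 n = 1 ->
  dist3 P (Q + t *: n) ^+ 2 = dist3 P Q ^+ 2 - 2 * t * dot3 (P - Q) n + t ^+ 2.
Proof.
move=> n1; have {n1} nn : dot3 n n = 1 by rewrite -sqr_enorm3 n1 expr1n.
have -> : t ^+ 2 = t ^+ 2 * dot3 n n by rewrite nn mulr1.
rewrite !sqr_enorm3 {nn}; case: P Q n => [[p1 p2] p3] [[q1 q2] q3] [[n1 n2] n3].
by rewrite /dot3/= /GRing.scale/=; ring.
Qed.

(** The squared distances differ by [2 t (P - Q) . n - t ^+ 2]. The first term gives
    [slope_part], which is dominated on the surface because [P - Q] is almost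
    tangent; the second one gives [jump_part], an approximate identity at [Q]. *)
Lemma quotient_split P Q n t : enorm3 n = 1 -> t != 0 ->
  0 < dist3 P Q -> 0 < dist3 P (Q + t *: n) ->
  ((dist3 P (Q + t *: n))^-1 - (dist3 P Q)^-1) / t =
  slope_part P Q n t - jump_part P Q n t.
Proof.
move=> n1 t0 d0 e0; have := sqr_dist3_shift P Q t n1.
rewrite /slope_part /jump_part /quotient_den.
set d := dist3 P Q in d0 *; set e := dist3 P _ in e0 *; set w := dot3 _ _.
move=> he; have hw : w = (d ^+ 2 + t ^+ 2 - e ^+ 2) / (2 * t).
  by rewrite he; field.
rewrite hw; field; rewrite t0 !gt_eqF//= addr_gt0//.
Qed.

Lemma cvg_dist3_shift P Q n (F : set_system R) {FF : Filter F} :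
  t @[t --> F] --> 0 -> dist3 P (Q + t *: n) @[t --> F] --> dist3 P Q.
Proof.
move=> F0; apply: cvg_enorm3; apply: cvgB; first exact: cvg_cst.
rewrite -[X in _ --> X]addr0 -(scale0r n); apply: cvgD; first exact: cvg_cst.
exact: cvgZr_tmp.
Qed.

Lemma cvg_quotient_den P Q n (F : set_system R) {FF : Filter F} :
  t @[t --> F] --> 0 ->
  quotient_den P Q n t @[t --> F] --> 2 * dist3 P Q ^+ 3.
Proof.
move=> /cvg_dist3_shift h.
rewrite (_ : 2 * _ = dist3 P Q * dist3 P Q * (dist3 P Q + dist3 P Q)); last by ring.
apply: cvgM; last by apply: cvgD; [exact: cvg_cst|exact: h].
by apply: cvgM; [exact: cvg_cst|exact: h].
Qed.

Lemma cvg_slope_part P Q n (F : set_system R) {FF : Filter F} : P != Q ->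
  t @[t --> F] --> 0 ->
  slope_part P Q n t @[t --> F] --> dot3 (P - Q) n / dist3 P Q ^+ 3.
Proof.
rewrite -dist3_gt0 => d0 F0.
have -> : dot3 (P - Q) n / dist3 P Q ^+ 3 =
    2 * dot3 (P - Q) n / (2 * dist3 P Q ^+ 3) by field; rewrite gt_eqF.
apply: cvgM; first exact: cvg_cst.
by apply: cvgV; [rewrite mulf_neq0 ?expf_neq0 ?gt_eqF|exact: cvg_quotient_den].
Qed.

Lemma cvg_jump_part P Q n (F : set_system R) {FF : Filter F} : P != Q ->
  t @[t --> F] --> 0 -> jump_part P Q n t @[t --> F] --> 0.
Proof.
rewrite -dist3_gt0 => d0 F0.
rewrite -[X in _ --> X](mul0r (2 * dist3 P Q ^+ 3)^-1); apply: cvgM => //.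
by apply: cvgV; [rewrite mulf_neq0 ?expf_neq0 ?gt_eqF|exact: cvg_quotient_den].
Qed.

(** The derivative is the limit of the same quotient, in which the jump part
    vanishes since [P] is fixed. *)
Lemma normal_kernelE P Q n : enorm3 n = 1 -> P != Q ->
  normal_kernel P Q n = dot3 (P - Q) n / dist3 P Q ^+ 3.
Proof.
move=> n1 PQ; have d0 : 0 < dist3 P Q by rewrite dist3_gt0.
have c0 : t @[t --> (0 : R)^'] --> (0 : R) by apply: cvg_within.
apply: cvg_lim => //.
have h : slope_part P Q n t - jump_part P Q n t @[t --> (0 : R)^'] -->
    dot3 (P - Q) n / dist3 P Q ^+ 3.
  rewrite -[X in _ --> X]subr0.
  by apply: cvgB; [exact: cvg_slope_part|exact: cvg_jump_part].
apply: cvg_trans h; apply: near_eq_cvg; near=> t.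
have t0 : t != 0 by near: t; exact: nbhs_dnbhs_neq.
have e0 : 0 < dist3 P (Q + t *: n).
  by near: t; apply: cvgr_gt d0; exact: cvg_dist3_shift.
by rewrite -quotient_split//= [t *: n + Q]addrC mulrC.
Unshelve. all: by end_near. Qed.

(** The bound on the angle keeps the cross term below
    [t dist3 P Q <= (dist3 P Q ^+ 2 + t ^+ 2) / 2]. *)
Lemma dist3_shift_ge P Q n t : enorm3 n = 1 -> 0 < t ->
  `|dot3 (P - Q) n| <= dist3 P Q / 2 ->
  (dist3 P Q ^+ 2 + t ^+ 2) / 2 <= dist3 P (Q + t *: n) ^+ 2.
Proof.
move=> n1 t0; rewrite ler_norml => /andP[_ h].
rewrite (sqr_dist3_shift _ _ _ n1).
have h2 : t * dot3 (P - Q) n <= t * (dist3 P Q / 2) by rewrite ler_wpM2l// ltW.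
have := sqr_ge0 (dist3 P Q - t); nra.
Qed.

Lemma ler_dist3_shift P Q n t : enorm3 n = 1 -> 0 <= t ->
  dist3 P Q - t <= dist3 P (Q + t *: n).
Proof.
move=> n1 t0; rewrite lerBlDr.
have -> : dist3 P Q = enorm3 ((P - (Q + t *: n)) + t *: n).
  by rewrite /dist3 opprD addrA subrK.
by apply: le_trans (ler_enorm3D _ _) _; rewrite enorm3Z n1 mulr1 ger0_norm.
Qed.

Local Notation mR := (measurableTypeR R).
Local Notation R3 := (mR * mR * mR)%type.

Lemma measurable_dot3 Q n : measurable_fun [set: R3] (fun P => dot3 (P - Q) n : mR).
Proof.
apply: continuous_measurable_R3; first exact: measurableT.
apply: continuous_subspaceT => P; apply: continuous_dot3; last exact: cvg_cst.
by apply: cvgB; [exact: cvg_id|exact: cvg_cst].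
Qed.

Lemma measurable_quotient_den Q n t :
  measurable_fun [set: R3] (fun P => quotient_den P Q n t : mR).
Proof.
have m1 := @measurable_dist3 R Q; have m2 := @measurable_dist3 R (Q + t *: n).
exact: (measurable_funM (measurable_funM m1 m2) (measurable_funD m1 m2)).
Qed.

Lemma measurable_slope_part Q n t :
  measurable_fun [set: R3] (fun P => slope_part P Q n t : mR).
Proof.
apply: measurable_funM.
  by apply: measurable_funM => //; exact: measurable_dot3.
exact: (measurableT_comp (@measurable_invr R) (measurable_quotient_den Q n t)).
Qed.

Lemma measurable_jump_part Q n t :
  measurable_fun [set: R3] (fun P => jump_part P Q n t : mR).
Proof.
apply: measurable_funM => //.
exact: (measurableT_comp (@measurable_invr R) (measurable_quotient_den Q n t)).
Qed.

End difference_quotient.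

(** * The normal against the surface *)

Section normal_estimates.
Context (R : realType) (alpha : R) (Omega : set (R * R * R)).
Hypothesis (alpha0 : 0 < alpha).
Variables (k : 'I_3) (V : set (R * R)) (W : set (R * R * R)) (f : R * R -> R).
Variables (P0 n : R * R * R).
Hypotheses (ch : graph_chart alpha Omega k V W f).
Hypotheses (bP0 : boundary Omega P0) (WP0 : W P0) (n1 : enorm3 n = 1).
Let x0 := drop_coord k P0.
Hypothesis tangent1 : dot3 n (put k (1, 0) (partial1 f x0)) = 0.
Hypothesis tangent2 : dot3 n (put k (0, 1) (partial2 f x0)) = 0.

Let P0E : P0 = put k x0 (f x0). Proof. by have [] := chart_eq ch bP0 WP0. Qed.

Let Vx0 : V x0. Proof. by have [] := chart_eq ch bP0 WP0. Qed.

(** Since [n] is orthogonal to the tangent plane, [P - P0] is seen by [n] only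
    through the error of the first order expansion of the chart. *)
Lemma dot3_chart_normal x : dot3 (put k x (f x) - P0) n =
  coord k n * (f x - f x0 - ((x - x0).1 * partial1 f x0 + (x - x0).2 * partial2 f x0)).
Proof. by rewrite {1}P0E putB (dot3_normal _ _ tangent1 tangent2). Qed.

Lemma norm_coord_unit : `|coord k n| <= 1.
Proof.
rewrite -n1; apply: le_trans (norm_le_enorm3 n); case: (n) => [[a b] c].
rewrite !prod_normE /=.
by case: (k) => -[|[|[|//]]] ?; rewrite /Defs.coord/= !le_max lexx ?orbT.
Qed.

Lemma ball_neighborhood (U : set (R * R * R)) (P : R * R * R) : open U -> U P ->
  exists2 e : R, 0 < e & forall Q, dist3 Q P < e -> U Q.
Proof.
move=> oU UP; have /nbhs_ballP[e /= e0 eU] : nbhs P U by exact: open_nbhs_nbhs.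
exists e => // Q QP; apply: eU; rewrite -ball_normE/= distrC.
by apply: le_lt_trans QP; exact: norm_le_enorm3.
Qed.

(** Near [P0] this is the expansion of the chart; far from [P0] the left-hand side
    is at most the distance, and the power of the distance is bounded below. *)
Lemma almost_tangent : exists2 C, 0 <= C & forall P, boundary Omega P ->
  `|dot3 (P - P0) n| <= C * dist3 P P0 `^ (1 + alpha).
Proof.
have C1f : C1_holder_on alpha V f by case: ch.
have [C C0 taylor] := holder_taylor alpha0 C1f.
have [r r0 hr] := chart_ball alpha0 ch bP0 WP0.
have rV : ball x0 r `<=` V by move=> x /hr [].
have oP := open_patch ch (ball_open x0 r).
have PP0 : (W `&` drop_coord k @^-1` ball x0 r) P0.
  by split => //=; exact: ballxx.
have [e e0 eU] := ball_neighborhood oP PP0.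
have a10 : 0 <= 1 + alpha by rewrite addr_ge0// ltW.
exists (C + e `^ (- alpha)); first by rewrite addr_ge0// powR_ge0.
move=> P bP; rewrite mulrDl.
have [Pe|eP] := ltP (dist3 P P0) e.
  have [WP /= Br] := eU _ Pe.
  have [VP PE] := chart_eq ch bP WP; set x := drop_coord k P in Br VP PE.
  rewrite PE dot3_chart_normal normrM.
  apply: (@le_trans _ _ (C * enorm2 (x - x0) `^ (1 + alpha))).
    apply: le_trans (taylor _ _ _ rV Br).
    by rewrite -[leRHS]mul1r ler_wpM2r// norm_coord_unit.
  apply: (@le_trans _ _ (C * dist3 (put k x (f x)) P0 `^ (1 + alpha))); last first.
    by rewrite lerDl mulr_ge0// powR_ge0.
  rewrite ler_wpM2l//; apply: ge0_ler_powR => //; rewrite ?nnegrE ?enorm2_ge0 ?dist3_ge0//.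
  by rewrite P0E; exact: dist3_put_ge.
have d0 : 0 < dist3 P P0 by exact: lt_le_trans eP.
apply: le_trans (le_dot3_enorm3 _ _) _; rewrite n1 mulr1 -/(dist3 P P0).
apply: (@le_trans _ _ (e `^ (- alpha) * dist3 P P0 `^ (1 + alpha))); last first.
  by rewrite lerDr mulr_ge0// powR_ge0.
rewrite powRN mulrC ler_pdivlMr ?powR_gt0// powRD ?(gt_eqF d0) ?implybT//.
rewrite powRr1 ?(ltW d0)// ler_wpM2l ?(ltW d0)//.
by apply: ge0_ler_powR; rewrite ?nnegrE ?(ltW alpha0) ?(ltW e0) ?(ltW d0).
Qed.

Lemma small_angle : exists2 e : R, 0 < e & forall P, boundary Omega P ->
  dist3 P P0 <= e -> `|dot3 (P - P0) n| <= dist3 P P0 / 2.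
Proof.
have [C C0 HC] := almost_tangent.
have c0 : 0 < 2 * C + 1 by rewrite ltr_wpDl// mulr_ge0.
exists ((2 * C + 1)^-1 `^ alpha^-1); first by rewrite powR_gt0// invr_gt0.
move=> P bP hP; apply: le_trans (HC _ bP) _.
have [->|PP0] := eqVneq P P0.
  by rewrite dist3_self powR0 ?mulr0 ?mul0r// gt_eqF// addr_gt0.
have d0 : 0 < dist3 P P0 by rewrite dist3_gt0.
rewrite powRD ?(gt_eqF d0) ?implybT// powRr1 ?(ltW d0)// mulrCA ler_wpM2l ?(ltW d0)//.
have : dist3 P P0 `^ alpha <= (2 * C + 1)^-1.
  have -> : (2 * C + 1)^-1 = ((2 * C + 1)^-1 `^ alpha^-1) `^ alpha.
    by rewrite -powRrM mulVf ?gt_eqF// powRr1// invr_ge0 ltW.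
  apply: ge0_ler_powR; [exact: ltW|by rewrite nnegrE ltW|by rewrite nnegrE powR_ge0|exact: hP].
move=> h; apply: (@le_trans _ _ (C * (2 * C + 1)^-1)); first by rewrite ler_wpM2l.
rewrite ler_pdivrMr//; lra.
Qed.

(** Close to [P0] the small angle prevents [P0 + t *: n] from approaching [P]; far
    from [P0] the triangle inequality does, for small [t]. *)
Lemma dist3_shift_ge_half : exists2 t0 : R, 0 < t0 & forall t P, 0 < t < t0 ->
  boundary Omega P -> dist3 P P0 / 2 <= dist3 P (P0 + t *: n).
Proof.
have [e e0 he] := small_angle; exists (e / 2); first by rewrite divr_gt0.
move=> t P /andP[t0 te] bP; have d0 := dist3_ge0 P P0.
have [Pe|eP] := leP (dist3 P P0) e.
  have h := dist3_shift_ge n1 t0 (he _ bP Pe).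
  rewrite -(ler_pXn2r (n := 2))// ?nnegrE ?dist3_ge0 ?divr_ge0//.
  by apply: le_trans h; rewrite expr_div_n; have := sqr_ge0 t; have := sqr_ge0 (dist3 P P0); lra.
apply: le_trans (ler_dist3_shift P P0 n1 (ltW t0)).
by have := lt_trans te _; lra.
Qed.

(** The gain of the exponent [alpha] makes the dominating function integrable on
    the surface, uniformly in [t]. *)
Lemma slope_part_le : exists C t0 : R, 0 < t0 /\
  forall t P, 0 < t < t0 -> boundary Omega P ->
  `|slope_part P P0 n t| <= C * dist3 P P0 `^ (alpha - 2).
Proof.
have [C C0 HC] := almost_tangent; have [t0 t00 Ht] := dist3_shift_ge_half.
exists (4 * C), t0; split => // t P tt bP.
have [->|PP0] := eqVneq P P0.
  rewrite /slope_part subrr (_ : dot3 0 n = 0) ?mulr0 ?mul0r ?normr0.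
    by rewrite mulr_ge0 ?powR_ge0// mulr_ge0.
  by rewrite /dot3/= !mul0r !addr0.
have d0 : 0 < dist3 P P0 by rewrite dist3_gt0.
have hd := Ht _ _ tt bP; have h := HC _ bP.
rewrite /slope_part /quotient_den; set d := dist3 P P0 in d0 hd h *.
set e := dist3 P _ in hd *.
have e0 : 0 < e by apply: lt_le_trans hd; rewrite divr_gt0.
have den0 : 0 < d * e * (d + e) by rewrite !mulr_gt0// addr_gt0.
rewrite normrM normfV (gtr0_norm den0) ler_pdivrMr// normrM ger0_norm//.
have -> : alpha - 2 = (1 + alpha) - 3%:R by ring.
rewrite powRB ?(gt_eqF d0) ?implybT// powR_mulrn ?(ltW d0)//.
set p := d `^ (1 + alpha) in h *.
have p0 : 0 <= p by exact: powR_ge0.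
apply: (@le_trans _ _ (2 * (C * p))); first by rewrite ler_wpM2l.
rewrite -[leLHS]mulr1.
have -> : 4 * C * (p / d ^+ 3) * (d * e * (d + e)) =
   2 * (C * p) * (2 * e * (d + e) / d ^+ 2) by field; rewrite gt_eqF.
rewrite ler_wpM2l ?mulr_ge0// ler_pdivlMr ?exprn_gt0//.
nra.
Qed.

End normal_estimates.

(** * Blowing up a chart *)

Section chart_blow_up.
Context (R : realType) (alpha : R) (Omega : set (R * R * R)).
Local Notation mR := (measurableTypeR R).
Local Notation R2 := (mR * mR)%type.
Local Notation R3 := (mR * mR * mR)%type.
Local Notation leb2 := (@lebesgue_measure R \x @lebesgue_measure R)%E.
Variable sigma : {measure set R3 -> \bar R}.
Hypotheses (alpha0 : 0 < alpha) (sigmaS : surface_measure alpha Omega sigma).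
Variables (k : 'I_3) (V : set (R * R)) (W : set (R * R * R)) (f : R * R -> R).
Hypothesis ch : graph_chart alpha Omega k V W f.

Lemma ge0_integral_homothety (c : R * R) (t : R) (G : R * R -> \bar R) : 0 < t ->
  measurable_fun [set: R2] G -> (forall x, 0 <= G x)%E ->
  (\int[leb2]_x G x = \int[leb2]_y ((t ^+ 2)%:E * G (c + t *: y)%R))%E.
Proof.
move=> t0 mG G0.
have E : (fun y : R * R => G (c + t *: y)) =
         (fun y : R * R => G (t * y.1 + 0 * y.2 + c.1, t * y.2 + c.2)).
  apply/funext => y; congr G; rewrite mul0r addr0 [_ + c.1]addrC [_ + c.2]addrC.
  by case: c.
have mA : measurable_fun [set: R2] (fun y : R2 => G (c + t *: y)).
  rewrite E; apply: (measurableT_comp mG); apply/measurable_fun_pairP; split => /=.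
    apply: measurable_funD => //; apply: measurable_funD => //;
    exact: measurable_funM.
  by apply: measurable_funD => //; exact: measurable_funM.
rewrite ge0_integralZl//; last by rewrite lee_fin sqr_ge0.
rewrite E ge0_integral_triangular// muleA -EFinM expr2 mulfV ?mul1e//.
by rewrite mulf_neq0// gt_eqF.
Qed.

Section scaling.
Variable B : set (R * R).
Hypotheses (oB : open B) (BV : B `<=` V).

(** The integrand of a surface integral in the coordinates [y = (x - c) / t] of the
    plane, extended by zero outside of the patch. *)
Definition scaled_patch (c : R * R) (t : R) (F : R * R * R -> R) (y : R * R) : R :=
  t ^+ 2 * ((fun x => F (put k x (f x)) * area_element f x) \_ B) (c + t *: y).

Let mB : measurable (B : set R2). Proof. exact: open_measurable_R2. Qed.

Let mJ : measurable_fun (B : set R2) (area_element f : _ -> mR).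
Proof. by apply: (measurable_chart oB BV); exact: (chart_area_continuous alpha0 ch). Qed.

Let measurable_shift (c : R * R) (t : R) :
  measurable_fun [set: R2] (fun y => c + t *: y : R2).
Proof.
apply/measurable_fun_pairP; split => /=; apply: measurable_funD => //.
  exact: (@measurable_funM _ _ _ _ (cst t) fst).
exact: (@measurable_funM _ _ _ _ (cst t) snd).
Qed.

Lemma measurable_scaled_patch c t (F : R * R * R -> R) :
  measurable_fun [set: R3] (F : _ -> mR) ->
  measurable_fun [set: R2] (scaled_patch c t F : _ -> mR).
Proof.
move=> mF; apply: measurable_funM => //.
apply: measurableT_comp (measurable_shift c t).
apply: (measurable_restrictT _ mB).1; apply: measurable_funM => //.
exact: (measurable_comp_chart ch oB BV mF).
Qed.

Let ge0_integral_scaled c t (h : R3 -> \bar R) : 0 < t ->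
  measurable_fun [set: R3] h -> (forall P, 0 <= h P)%E ->
  (\int[sigma]_(P in surface_patch Omega k W B) h P = \int[leb2]_y ((t ^+ 2)%:E *
    ((fun x => h (put k x (f x)) * (area_element f x)%:E) \_ B) (c + t *: y)%R))%E.
Proof.
move=> t0 mh h0.
rewrite (ge0_integral_patch alpha0 sigmaS ch oB BV)//; last exact: measurable_funTS.
rewrite integral_mkcond; apply: ge0_integral_homothety => //.
  apply: (measurable_restrictT _ mB).1; apply: emeasurable_funM.
    exact: (measurable_comp_chart ch oB BV mh).
  exact/measurable_EFinP.
move=> x; rewrite patchE; case: ifP => // _.
by rewrite mule_ge0// lee_fin area_element_ge0.
Qed.

(** The nonnegative case, applied to the positive and to the negative part. *)
Lemma integral_scaled_patch c t (F : R * R * R -> R) : 0 < t ->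
  measurable_fun [set: R3] (F : _ -> mR) ->
  (\int[sigma]_(P in surface_patch Omega k W B) (F P)%:E =
   \int[leb2]_y (scaled_patch c t F y)%:E)%E.
Proof.
move=> t0 mF.
have max0M (a : R) (x : R * R) : t ^+ 2 * (Num.max a 0 * area_element f x) =
    Num.max (t ^+ 2 * (a * area_element f x)) 0.
  have p : 0 <= t ^+ 2 by exact: sqr_ge0.
  by rewrite maxr_pMl ?area_element_ge0// mul0r maxr_pMr// mulr0.
have mE : measurable_fun [set: R3] (fun P => (F P)%:E) by exact/measurable_EFinP.
rewrite integralE [RHS]integralE; congr (_ - _)%E.
- rewrite (ge0_integral_scaled c t0)//; last exact: measurable_funepos.
  apply: eq_integral => y _; rewrite funeposE /scaled_patch !patchE.
  case: ifP => _; last by rewrite mulr0 mule0 maxxx.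
  rewrite funeposE -!EFin_max -!EFinM; congr EFin.
  exact: max0M.
- rewrite (ge0_integral_scaled c t0)//; last exact: measurable_funeneg.
  apply: eq_integral => y _; rewrite funenegE /scaled_patch !patchE.
  case: ifP => _; last by rewrite mulr0 mule0 oppe0 maxxx.
  rewrite funenegE -!EFinN -!EFin_max -!EFinM; congr EFin.
  by rewrite max0M mulNr mulrN.
Qed.

End scaling.

End chart_blow_up.

(** * The jump *)

Section jump_of_chart.
Context (R : realType) (alpha : R) (Omega : set (R * R * R)).
Local Notation mR := (measurableTypeR R).
Local Notation R2 := (mR * mR)%type.
Local Notation R3 := (mR * mR * mR)%type.
Local Notation leb2 := (@lebesgue_measure R \x @lebesgue_measure R)%E.
Variable sigma : {measure set R3 -> \bar R}.
Hypotheses (alpha0 : 0 < alpha) (sigmaS : surface_measure alpha Omega sigma).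
Variables (k : 'I_3) (V : set (R * R)) (W : set (R * R * R)) (f : R * R -> R).
Variables (P0 n : R * R * R).
Hypotheses (ch : graph_chart alpha Omega k V W f).
Hypotheses (bP0 : boundary Omega P0) (WP0 : W P0) (n1 : enorm3 n = 1).
Let x0 := drop_coord k P0.
Hypothesis tangent1 : dot3 n (put k (1, 0) (partial1 f x0)) = 0.
Hypothesis tangent2 : dot3 n (put k (0, 1) (partial2 f x0)) = 0.

Let P0E : P0 = put k x0 (f x0). Proof. by have [] := chart_eq ch bP0 WP0. Qed.

Let Vx0 : V x0. Proof. by have [] := chart_eq ch bP0 WP0. Qed.

Let a1 := partial1 f x0.
Let a2 := partial2 f x0.
Let slope (t : R) (y : R * R) : R := (f (x0 + t *: y) - f x0) / t.

Let shiftB t y : 0 < t ->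
  put k (x0 + t *: y) (f (x0 + t *: y)) - P0 = t *: put k y (slope t y).
Proof.
move=> t0; rewrite {1}P0E putB addrAC subrr add0r.
have -> : f (x0 + t *: y) - f x0 = t * slope t y.
  by rewrite /slope mulrCA divff ?mulr1// gt_eqF.
by case: (k) => -[|[|[|//]]] ?.
Qed.

(** In the blown-up coordinates the surface is the graph of [slope t], and the
    factor [t ^+ 2] of the area compensates the size of the kernel exactly. *)
Lemma jump_part_scaled t y : 0 < t ->
  t ^+ 2 * jump_part (put k (x0 + t *: y) (f (x0 + t *: y))) P0 n t =
  (enorm3 (put k y (slope t y)) * enorm3 (put k y (slope t y) - n) *
   (enorm3 (put k y (slope t y)) + enorm3 (put k y (slope t y) - n)))^-1.
Proof.
move=> t0; rewrite /jump_part /quotient_den /dist3 opprD addrA (shiftB _ t0).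
rewrite -scalerBr !enorm3Z (gtr0_norm t0).
set d := enorm3 _; set e := enorm3 _.
have -> : t * d * (t * e) * (t * d + t * e) = t ^+ 3 * (d * e * (d + e)) by ring.
by rewrite invfM !mulrA -exprSr divff ?mul1r// expf_neq0// gt_eqF.
Qed.

Let shift_cvg y : x0 + t *: y @[t --> 0^'+] --> x0.
Proof.
rewrite -[X in _ --> X]addr0 -(scale0r y); apply: cvgD; first exact: cvg_cst.
by apply: cvgZr_tmp; exact: cvg_at_right_filter cvg_id.
Qed.

Let slope_cvg y : slope t y @[t --> 0^'+] --> y.1 * a1 + y.2 * a2.
Proof.
have df : differentiable f x0 by case: ch => _ [df _ _] _ _; exact: df.
rewrite /a1 /a2 -derive_partials//.
have : h^-1 *: ((f \o shift x0) (h *: y) - f x0) @[h --> (0 : R)^'] --> 'D_y f x0.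
  exact: (@diff_derivable _ _ _ f x0 y df).
move=> /cvg_dnbhs_at_right; apply: cvg_trans; apply: near_eq_cvg; near=> t.
by rewrite /slope [x0 + _]addrC mulrC.
Unshelve. all: by end_near. Qed.

Let quadratic (y : R * R) : R :=
  y.1 ^+ 2 + y.2 ^+ 2 + (a1 * y.1 + a2 * y.2) ^+ 2.

Let tangent (y : R * R) : R * R * R := put k y (y.1 * a1 + y.2 * a2).

Let dot3_tangent y : dot3 (tangent y) n = 0.
Proof. by rewrite /tangent (dot3_normal _ _ tangent1 tangent2) subrr mulr0. Qed.

Let enorm3_tangent y : enorm3 (tangent y) = Num.sqrt (quadratic y).
Proof.
rewrite /enorm3 /tangent dot3_put /quadratic -!expr2.
by rewrite (mulrC y.1) (mulrC y.2).
Qed.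

Let enorm3_tangentB y : enorm3 (tangent y - n) = Num.sqrt (1 + quadratic y).
Proof.
rewrite /enorm3; congr Num.sqrt.
have -> : dot3 (tangent y - n) (tangent y - n) =
    dot3 n n + dot3 (tangent y) (tangent y) - 2 * dot3 (tangent y) n.
  by rewrite /dot3/=; ring.
rewrite dot3_tangent mulr0 subr0 -!sqr_enorm3 n1 expr1n enorm3_tangent.
by rewrite sqr_sqrtr// /quadratic !addr_ge0// sqr_ge0.
Qed.

Let jump_kernel0 : jump_kernel (0 : R) = 0.
Proof. by rewrite /jump_kernel sqrtr0 !mul0r invr0. Qed.

Let slope0 t : slope t 0 = 0.
Proof. by rewrite /slope scaler0 addr0 subrr mul0r. Qed.

Let put00 : put k (0 : R * R) 0 = 0.
Proof. by case: (k) => -[|[|[|//]]] ?. Qed.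

Let enorm30 : enorm3 (0 : R * R * R) = 0.
Proof. by apply/eqP; rewrite enorm3_eq0. Qed.

(** The graphs of [slope t] converge to the tangent plane, on which the distance to
    [n] is given by Pythagoras. *)
Lemma jump_part_scaled_cvg y :
  t ^+ 2 * jump_part (put k (x0 + t *: y) (f (x0 + t *: y))) P0 n t
  @[t --> 0^'+] --> jump_kernel (quadratic y).
Proof.
pose g (t : R) := (enorm3 (put k y (slope t y)) * enorm3 (put k y (slope t y) - n) *
   (enorm3 (put k y (slope t y)) + enorm3 (put k y (slope t y) - n)))^-1.
suff : g t @[t --> 0^'+] --> jump_kernel (quadratic y).
  apply: cvg_trans; apply: near_eq_cvg; near=> t.
  by rewrite jump_part_scaled.
have [y0|y0] := eqVneq y 0.
  rewrite y0; have -> : quadratic 0 = 0 by rewrite /quadratic/= !mulr0 addr0 expr0n/= !addr0.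
  rewrite jump_kernel0 (_ : g = cst 0); first exact: cvg_cst.
  by apply/funext => t; rewrite /g y0 slope0 put00 enorm30 !mul0r invr0.
have q0 : 0 < quadratic y.
  rewrite ltr_pwDl ?sqr_ge0// -sqr_enorm2 exprn_gt0//.
  by rewrite enorm2_gt0.
have c1 : enorm3 (put k y (slope t y)) @[t --> 0^'+] --> enorm3 (tangent y).
  by apply: cvg_enorm3; apply: cvg_put; [exact: cvg_cst|exact: slope_cvg].
have c2 : enorm3 (put k y (slope t y) - n) @[t --> 0^'+] --> enorm3 (tangent y - n).
  apply: cvg_enorm3; apply: cvgB; last exact: cvg_cst.
  by apply: cvg_put; [exact: cvg_cst|exact: slope_cvg].
move: c1 c2; rewrite enorm3_tangent enorm3_tangentB => c1 c2.
apply: cvgV; last by apply: cvgM; [exact: cvgM|exact: cvgD].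
have s1 : 0 < Num.sqrt (quadratic y) by rewrite sqrtr_gt0.
have s2 : 0 < Num.sqrt (1 + quadratic y) by rewrite sqrtr_gt0 addr_gt0.
by rewrite gt_eqF// !mulr_gt0// addr_gt0.
Unshelve. all: by end_near. Qed.

Lemma jump_part_scaled_le t y : 0 < t ->
  `|dot3 (put k (x0 + t *: y) (f (x0 + t *: y)) - P0) n| <=
    dist3 (put k (x0 + t *: y) (f (x0 + t *: y))) P0 / 2 ->
  `|t ^+ 2 * jump_part (put k (x0 + t *: y) (f (x0 + t *: y))) P0 n t| <=
  2 * `|jump_bound (y.1 ^+ 2 + y.2 ^+ 2)|.
Proof.
move=> t0 /(dist3_shift_ge n1 t0).
rewrite jump_part_scaled// /dist3 opprD addrA (shiftB _ t0).
rewrite -scalerBr !enorm3Z (gtr0_norm t0).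
have [->|y0] := eqVneq y 0.
  by move=> _; rewrite slope0 put00 enorm30 !mul0r invr0 normr0 mulr_ge0.
have Dy : enorm2 y <= enorm3 (put k y (slope t y)).
  have := dist3_put_ge k y 0 (slope t y) 0.
  by rewrite /dist3 put00 !subr0.
set d := enorm3 _ in Dy *; set e := enorm3 _.
rewrite !exprMn -[X in _ + X]mulr1 -mulrDr -mulrA ler_pM2l ?exprn_gt0// => hd.
have ny : 0 < enorm2 y by rewrite enorm2_gt0.
have d0 : 0 < d by exact: lt_le_trans Dy.
have e0 : 0 <= e by exact: enorm3_ge0.
have {}e0 : 0 < e.
  rewrite lt_def e0 andbT; apply/eqP => eE; move: hd; rewrite eE expr0n/=.
  have := sqr_ge0 d; lra.
have den0 : 0 < d * e * (d + e) by rewrite !mulr_gt0// addr_gt0.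
rewrite normfV (gtr0_norm den0) /jump_bound -/(enorm2 y) -sqr_enorm2.
have b0 : 0 < enorm2 y * (1 + enorm2 y ^+ 2).
  by rewrite mulr_gt0// ltr_pwDl// sqr_ge0.
rewrite normfV (gtr0_norm b0) -[2]invrK -invfM lef_pV2 ?posrE//; last first.
  by rewrite mulr_gt0// invr_gt0.
have dy2 : enorm2 y ^+ 2 <= d ^+ 2 by rewrite ler_pXn2r// nnegrE ltW.
apply: (@le_trans _ _ (d * e ^+ 2)); last first.
  have : 0 <= d * e * d by rewrite !mulr_ge0// ltW.
  by rewrite expr2; lra.
rewrite mulrCA; apply: ler_pM => //; rewrite ?(ltW ny)//.
  by rewrite mulr_ge0 ?invr_ge0// addr_ge0// sqr_ge0.
by apply: le_trans hd; rewrite mulrC ler_pM2r ?invr_gt0// addrC lerD2r.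
Qed.

(** Dominated convergence in the blown-up coordinates: the density and the area
    element tend to their values at [P0], the kernel to that of the tangent
    plane, and the area element cancels against the mass of that kernel. *)
Lemma near_jump_limit (v : R * R * R -> R) (c : R) :
  measurable_fun [set: R3] (v : _ -> mR) -> (forall P, `|v P| <= c) ->
  v P @[P --> within (boundary Omega) (nbhs P0)] --> v P0 ->
  exists r : R, [/\ 0 < r, open (W `&` drop_coord k @^-1` ball x0 r),
    (W `&` drop_coord k @^-1` ball x0 r) P0,
    (forall t, 0 < t -> sigma.-integrable (surface_patch Omega k W (ball x0 r))
      (fun P => (v P * jump_part P P0 n t)%:E)) &
    \int[sigma]_(P in surface_patch Omega k W (ball x0 r)) (v P * jump_part P P0 n t)
      @[t --> 0^'+] --> 2 * pi * v P0].
Proof.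
move=> mv vc cv.
have [r1 r10 hr1] := chart_ball alpha0 ch bP0 WP0.
have [e e0 he] := small_angle alpha0 ch bP0 WP0 n1 tangent1 tangent2.
have cphi : put k x (f x) @[x --> x0] --> P0.
  rewrite [X in _ --> X]P0E; apply: cvg_put; first exact: cvg_id.
  exact: (chart_continuous ch Vx0).
have [r2 /= r20 hr2] : exists2 r2 : R, 0 < r2 &
    forall x, ball x0 r2 x -> dist3 (put k x (f x)) P0 < e.
  have : \forall x \near x0, dist3 (put k x (f x)) P0 < e.
    have cd : dist3 (put k x (f x)) P0 @[x --> x0] --> (0 : R).
      rewrite -(dist3_self P0).
      by apply: cvg_enorm3; apply: cvgB; [exact: cphi|exact: cvg_cst].
    by apply: cvgr_lt cd _ e0.
  by move=> /nbhs_ballP[r2 /= r20 h]; exists r2.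
pose r := Num.min r1 r2; have r0 : 0 < r by rewrite lt_min r10.
have rr1 : ball x0 r `<=` ball x0 r1 by apply: le_ball; rewrite ge_min lexx.
have rr2 : ball x0 r `<=` ball x0 r2 by apply: le_ball; rewrite ge_min lexx orbT.
have oB : open (ball x0 r) by exact: ball_open.
have BV : ball x0 r `<=` V by move=> x /rr1/hr1[].
have oP := open_patch ch oB.
pose B : set (R * R) := ball x0 r.
pose F t P := v P * jump_part P P0 n t.
have mF t : measurable_fun [set: R3] (F t : _ -> mR).
  by apply: measurable_funM => //; exact: measurable_jump_part.
have mnF t : measurable_fun [set: R3] ((fun P => `|F t P|) : _ -> mR).
  exact: (measurableT_comp (@normr_measurable R setT) (mF t)).
pose q t y := scaled_patch k f B x0 t (F t) y.
pose l y := v P0 * area_element f x0 * jump_kernel (quadratic y).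
pose Jm := area_element f x0 + 1.
have Jm0 : 0 <= Jm by rewrite addr_ge0// area_element_ge0.
have c0 : 0 <= c by apply: le_trans (vc P0).
pose g y := (c * Jm * 2) * `|jump_bound (y.1 ^+ 2 + y.2 ^+ 2)|.
have m2 : measurable_fun [set: R2] (fun z : R2 => z.1 ^+ 2 + z.2 ^+ 2 : mR).
  by apply: measurable_funD; apply: measurable_funX.
have mq t : measurable_fun [set: R2] (q t : _ -> mR).
  exact: (measurable_scaled_patch alpha0 ch oB BV).
have qE t y : q t y = if x0 + t *: y \in B then
    v (put k (x0 + t *: y) (f (x0 + t *: y))) * area_element f (x0 + t *: y) *
    (t ^+ 2 * jump_part (put k (x0 + t *: y) (f (x0 + t *: y))) P0 n t) else 0.
  rewrite /q /scaled_patch patchE; case: ifP => _; last by rewrite mulr0.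
  by rewrite /F; ring.
have ig : leb2.-integrable [set: R2] (EFin \o g).
  apply/integrableP; split.
    apply/measurable_EFinP; apply: measurable_funM => //.
    apply: measurableT_comp => //.
    exact: (measurableT_comp (@measurable_jump_bound R)).
  rewrite (_ : (fun x => _) = (fun y : R2 => (c * Jm * 2)%:E *
      `|jump_bound (y.1 ^+ 2 + y.2 ^+ 2)|%:E)%E); last first.
    apply/funext => y; rewrite /g/= ger0_norm ?EFinM//.
    by rewrite !mulr_ge0.
  rewrite ge0_integralZl//; last 2 first.
    apply/measurable_EFinP; apply: measurableT_comp => //.
    exact: (measurableT_comp (@measurable_jump_bound R)).
    by rewrite lee_fin !mulr_ge0.
  apply: lte_mul_pinfty; rewrite ?lee_fin ?mulr_ge0//.
  exact: integral_jump_bound_plane_lty.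
have qg t y : 0 < t -> `|q t y| <= g y.
  move=> t0; rewrite qE; case: ifPn => [|_]; last by rewrite normr0 !mulr_ge0.
  rewrite inE => By; rewrite normrM /g -mulrA; apply: ler_pM => //.
    rewrite normrM; apply: ler_pM => //.
    rewrite ger0_norm ?area_element_ge0//.
    by have [] := hr1 _ (rr1 _ By).
  apply: jump_part_scaled_le => //; apply: he.
    by have [] := chart_mem ch (BV _ By).
  by apply: ltW; apply: hr2; exact: rr2.
have transfer t : 0 < t ->
    (\int[sigma]_(P in surface_patch Omega k W B) (F t P)%:E = \int[leb2]_y (q t y)%:E)%E.
  by move=> t0; exact: (integral_scaled_patch alpha0 sigmaS ch oB BV).
have ql y : q t y @[t --> 0^'+] --> l y.
  have inB : \forall t \near 0^'+, B (x0 + t *: y).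
    exact: (@shift_cvg y _ (nbhsx_ballx x0 r r0)).
  have cf : put k (x0 + t *: y) (f (x0 + t *: y)) @[t --> 0^'+] --> P0.
    exact: (cvg_comp _ _ (shift_cvg y) cphi).
  have cfw : put k (x0 + t *: y) (f (x0 + t *: y)) @[t --> 0^'+] -->
      within (boundary Omega) (nbhs P0).
    move=> U hU; have h := cf _ hU.
    rewrite /= /nbhs/=; near=> t.
    suff : boundary Omega (put k (x0 + t *: y) (f (x0 + t *: y))).
      by near: t; exact: h.
    have Bt : B (x0 + t *: y) by near: t.
    by have [] := chart_mem ch (BV _ Bt).
  have cq : v (put k (x0 + t *: y) (f (x0 + t *: y))) * area_element f (x0 + t *: y) *
    (t ^+ 2 * jump_part (put k (x0 + t *: y) (f (x0 + t *: y))) P0 n t)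
    @[t --> 0^'+] --> l y.
    apply: cvgM; last exact: jump_part_scaled_cvg.
    apply: cvgM; first exact: (cvg_comp _ _ cfw cv).
    exact: (cvg_comp _ _ (shift_cvg y) (chart_area_continuous alpha0 ch Vx0)).
  apply: cvg_trans cq; apply: near_eq_cvg; near=> t.
  by rewrite qE mem_set//; near: t.
have mjk : measurable_fun [set: R2] (fun y => jump_kernel (quadratic y) : mR).
  apply: (measurableT_comp (@measurable_jump_kernel R)).
  apply: measurable_funD => //; apply: measurable_funX.
  apply: measurable_funD.
    exact: (@measurable_funM _ _ _ _ (cst a1) fst).
  exact: (@measurable_funM _ _ _ _ (cst a2) snd).
have ml : measurable_fun [set: R2] (l : _ -> mR) by exact: measurable_funM.
have [_ dct] := @dominated_cvg_at_right _ _ R leb2 setT measurableT q l g 1 ltr01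
  (fun t _ => mq t) ml ig (fun y _ => ql y)
  (fun t y t01 _ => qg t y (andP t01).1).
exists r; split => //.
- by split => //=; exact: ballxx.
- move=> t t0; apply/integrableP; split.
    by apply: measurable_funTS; apply/measurable_EFinP; exact: mF.
  have := integral_scaled_patch alpha0 sigmaS ch oB BV x0 t0 (mnF t).
  move=> /= ->; apply: (@le_lt_trans _ _ (\int[leb2]_y (g y)%:E)%E).
    apply: ge0_le_integral => //.
    + move=> y _; rewrite lee_fin /scaled_patch patchE mulr_ge0 ?sqr_ge0//.
      by case: ifP => // _; rewrite mulr_ge0 ?area_element_ge0.
    + apply/measurable_EFinP.
      exact: (measurable_scaled_patch alpha0 ch oB BV x0 t (mnF t)).
    + by case/integrableP : ig.
    + move=> y _; rewrite lee_fin (le_trans _ (qg t y t0))//.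
      rewrite /q /scaled_patch !patchE [leRHS]normrM (ger0_norm (sqr_ge0 t)).
      rewrite ler_wpM2l ?sqr_ge0//; case: ifP => _; last by rewrite normr0.
      by rewrite [leRHS]normrM (ger0_norm (area_element_ge0 _ _)).
  exact: integrable_lty ig.
- have -> : 2 * pi * v P0 = \int[leb2]_y l y.
    have J0 : 0 < area_element f x0.
      by rewrite sqrtr_gt0 -addrA ltr_pwDl// addr_ge0// sqr_ge0.
    have ijq : leb2.-integrable [set: R2] (fun y => (jump_kernel (quadratic y))%:E).
      apply/integrableP; split; first exact/measurable_EFinP.
      under eq_integral do rewrite gee0_abs ?lee_fin ?jump_kernel_ge0//.
      by rewrite integral_jump_kernel_plane ltry.
    have -> : \int[leb2]_y l y =
        v P0 * area_element f x0 * \int[leb2]_y jump_kernel (quadratic y).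
      exact: (RintegralZl _ measurableT ijq).
    rewrite [X in _ = _ * X]/Rintegral integral_jump_kernel_plane/=.
    by rewrite -/(area_element f x0); field; rewrite gt_eqF.
  apply: cvg_trans dct; apply: near_eq_cvg; near=> t.
  by rewrite /Rintegral transfer.
Unshelve. all: by end_near. Qed.

End jump_of_chart.

(** * One-sided normal derivatives of the potential *)

Section single_layer.
Context (R : realType) (alpha : R) (Omega : set (R * R * R)).
Local Notation mR := (measurableTypeR R).
Local Notation R2 := (mR * mR)%type.
Local Notation R3 := (mR * mR * mR)%type.
Variable sigma : {measure set R3 -> \bar R}.
Variable v : R * R * R -> R.
Hypotheses (alpha0 : 0 < alpha) (alpha1 : alpha <= 1).
Hypotheses (Omega_bounded : bounded_set Omega).
Hypotheses (OmegaC : boundary_C1_holder alpha Omega).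
Hypotheses (sigmaS : surface_measure alpha Omega sigma).
Hypotheses (cv : {within boundary Omega, continuous v}).

Let D := boundary Omega.

Let mD : measurable (D : set R3). Proof. exact: measurable_boundary. Qed.

Lemma density_bounded : exists c : R, forall P, `|(v \_ D) P| <= c.
Proof.
have /compact_bounded[M [_ HM]] : compact (v @` D).
  by apply: continuous_compact => //; exact: bounded_boundary_compact.
exists (`|M| + 1) => P; rewrite patchE; case: ifPn => [|_].
  by rewrite inE => DP; apply: HM; [rewrite ltr_pwDr// ler_norm|exists P].
by rewrite normr0 addr_ge0.
Qed.

Let mv : measurable_fun [set: R3] (v \_ D : _ -> mR).
Proof. by apply: (measurable_restrictT _ mD).1; exact: continuous_measurable_R3. Qed.

Let vD P : D P -> (v \_ D) P = v P.
Proof. by move=> DP; rewrite patchE mem_set. Qed.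

Lemma integrable_dist3_powR (M : R * R * R) (b c : R) : 0 < b <= 2 ->
  sigma.-integrable D (fun P => (c * dist3 P M `^ (b - 2))%:E).
Proof.
move=> b2.
have mp : measurable_fun [set: mR] (fun x : mR => x `^ (b - 2) : mR).
  exact: measurable_powR.
have mh : measurable_fun [set: R3] (fun P => (dist3 P M `^ (b - 2))%:E).
  by apply/measurable_EFinP; exact: (measurableT_comp mp (measurable_dist3 M)).
apply: (@integrableZl _ _ _ _ _ mD c (fun P => (dist3 P M `^ (b - 2))%:E)).
apply/integrableP; split; first exact: measurable_funTS.
under eq_integral do rewrite gee0_abs ?lee_fin ?powR_ge0//.
exact: (integral_dist3_powR_lty alpha0 Omega_bounded OmegaC sigmaS).
Qed.

Lemma integrable_le_dist3_powR (h : R * R * R -> R) (M : R * R * R) (b c : R)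
    (E : set R3) :
  measurable E -> E `<=` D -> 0 < b <= 2 ->
  measurable_fun E (h : _ -> mR) ->
  (forall P, E P -> `|h P| <= c * dist3 P M `^ (b - 2)) ->
  sigma.-integrable E (fun P => (h P)%:E).
Proof.
move=> mE ED b2 mh hc.
apply: (@le_integrable _ _ _ _ _ mE _ (fun P => (c * dist3 P M `^ (b - 2))%:E)).
- exact/measurable_EFinP.
- move=> P EP; rewrite lee_fin (le_trans (hc _ EP))//.
  exact: ler_norm.
- by apply: (integrableS mD) => //; exact: integrable_dist3_powR.
Qed.

Lemma potential_integrable (M : R * R * R) :
  sigma.-integrable D (fun P => (v P / dist3 P M)%:E).
Proof.
have [c hc] := density_bounded.
have i1 : 0 < (1 : R) <= 2 by rewrite ltr01/= ler1n.
apply: (@integrable_le_dist3_powR _ M 1 c D mD _ i1) => //.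
  apply: measurable_funM; first exact: continuous_measurable_R3.
  apply: measurable_funTS.
  exact: (measurableT_comp (@measurable_invr R) (measurable_dist3 M)).
move=> P DP; have := hc P; rewrite (vD DP) => {}hc.
have -> : 1 - 2 = -1 :> R by ring.
rewrite powR_inv1 ?dist3_ge0// normrM normfV (ger0_norm (dist3_ge0 _ _)).
by rewrite ler_wpM2r ?invr_ge0 ?dist3_ge0.
Qed.

Section at_boundary_point.
Variables (k : 'I_3) (V : set (R * R)) (W : set (R * R * R)) (f : R * R -> R).
Variables (P0 n : R * R * R).
Hypotheses (ch : graph_chart alpha Omega k V W f).
Hypotheses (bP0 : boundary Omega P0) (WP0 : W P0) (n1 : enorm3 n = 1).
Hypothesis tangent1 : dot3 n (put k (1, 0) (partial1 f (drop_coord k P0))) = 0.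
Hypothesis tangent2 : dot3 n (put k (0, 1) (partial2 f (drop_coord k P0))) = 0.

Let m1 : measurable ([set P0] : set R3).
Proof.
rewrite (_ : [set P0] = ([set P0.1.1] `*` [set P0.1.2]) `*` [set P0.2]).
  by apply: measurableX; [apply: measurableX|].
by case: P0 => [[a b] c']; apply/seteqP; split=> [_ ->//|[[x y] z] /= [[-> ->] ->]].
Qed.

Lemma surface_measure_set1 : sigma [set P0] = 0%E.
Proof.
have [_ sE] := sigmaS; rewrite (sE _ _ _ _ ch)//; last by move=> _ ->; split.
have [Vx0 P0E] := chart_eq ch bP0 WP0.
set x0 := drop_coord k P0 in Vx0 P0E.
have -> : [set x | V x /\ [set P0] (put k x (f x))] = [set x0.1] `*` [set x0.2].
  apply/seteqP; split=> [x [_ xP]|x [/= x1 x2]].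
    by rewrite /x0 -xP drop_coord_put.
  have -> : x = x0 by rewrite [x]surjective_pairing x1 x2 -surjective_pairing.
  by split => //; exact: esym.
have m2 : measurable ([set x0.1] `*` [set x0.2] : set R2) by exact: measurableX.
apply: null_set_integral => //; last first.
  rewrite /= product_measure1E//.
  by rewrite [X in (X * _)%E](_ : _ = 0%E) ?mul0e//; exact: lebesgue_measure_set1.
apply: (eq_measurable_fun (cst (area_element f x0)%:E)) => // x.
by rewrite inE /= => -[x1 x2]; rewrite [x]surjective_pairing x1 x2 -surjective_pairing.
Qed.

Let kernel P : R := dot3 (P - P0) n / dist3 P P0 ^+ 3.

Let u := simple_layer Omega sigma v.

Let quot t P : R := ((dist3 P (P0 + t *: n))^-1 - (dist3 P P0)^-1) / t.

Let c := sval (cid density_bounded).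

Let vc P : `|(v \_ D) P| <= c.
Proof. exact: svalP (cid density_bounded) P. Qed.

Let c0 : 0 <= c. Proof. exact: le_trans (normr_ge0 _) (vc P0). Qed.

(** Both kernels take conventional values at the pole [P0], which is a null set
    of the surface. *)
Lemma integral_off_pole (g h : R * R * R -> R) :
  measurable_fun [set: R3] (h : _ -> mR) ->
  (forall P, D P -> P <> P0 -> g P = h P) ->
  sigma.-integrable D (fun P => (h P)%:E) ->
  sigma.-integrable D (fun P => (g P)%:E) /\
  \int[sigma]_(P in D) g P = \int[sigma]_(P in D) h P.
Proof.
move=> mh gh ih.
have mg : measurable_fun (D : set R3) (fun P => (g P)%:E).
  rewrite -(setD1K (bP0 : D P0)); apply/measurable_funU => //.
    by apply: measurableD.
  split.
    by apply: (eq_measurable_fun (cst (g P0)%:E)) => // P; rewrite inE => ->.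
  apply: (eq_measurable_fun (fun P => (h P)%:E)).
    by move=> P; rewrite inE => -[DP PP0]; rewrite gh.
  by apply: measurable_funTS; exact/measurable_EFinP.
have mhD : measurable_fun (D : set R3) (fun P => (h P)%:E).
  by apply: measurable_funTS; exact/measurable_EFinP.
have ae (F : R -> \bar R) : ae_eq sigma D (fun P => F (g P)) (fun P => F (h P)).
  exists [set P0]; split => //; first exact: surface_measure_set1.
  move=> P /= /not_implyP[DP gP]; apply: contrapT => PP0; apply: gP.
  by rewrite gh.
split; last by rewrite /Rintegral; congr fine; apply: ae_eq_integral => //; exact: (ae EFin).
have /integrableP[_ ihf] := ih; apply/integrableP; split => //.
suff -> : (\int[sigma]_(P in D) `|(g P)%:E| = \int[sigma]_(P in D) `|(h P)%:E|)%E.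
  exact: ihf.
apply: ae_eq_integral => //; [exact: measurableT_comp|exact: measurableT_comp|].
exact: (ae (fun x => `|x%:E|%E)).
Qed.

(** The restriction [v \_ D] makes the density measurable on the whole space. *)
Lemma difference_quotientE t : 0 < t ->
  (u (P0 + t *: n) - u P0) / dist3 (P0 + t *: n) P0 =
  \int[sigma]_(P in D) ((v \_ D) P * quot t P).
Proof.
move=> t0; have -> : dist3 (P0 + t *: n) P0 = t.
  by rewrite /dist3 addrAC subrr add0r enorm3Z n1 mulr1 gtr0_norm.
have i1 := potential_integrable (P0 + t *: n); have i0 := potential_integrable P0.
rewrite /u /simple_layer -RintegralB//.
rewrite -(RintegralZr _ mD (integrableB mD i1 i0)).
apply: eq_Rintegral => P; rewrite inE => DP; rewrite vD// /quot.
by rewrite -mulrBr mulrA.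
Qed.

Let measurable_kernel0 : measurable_fun [set: R3] (kernel : _ -> mR).
Proof.
apply: measurable_funM; first exact: measurable_dot3.
apply: (measurableT_comp (@measurable_invr R)).
by apply: measurable_funX; exact: measurable_dist3.
Qed.

Let alpha2 : 0 < alpha <= 2.
Proof. by rewrite alpha0 (le_trans alpha1)// ler1n. Qed.

(** At the pole [slope_part] is [0] for every [t], and so is [kernel]. *)
Let slope_limit :
  sigma.-integrable D (fun P => ((v \_ D) P * kernel P)%:E) /\
  exists2 t0 : R, 0 < t0 &
    (forall t, 0 < t < t0 ->
      sigma.-integrable D (fun P => ((v \_ D) P * slope_part P P0 n t)%:E)) /\
    \int[sigma]_(P in D) ((v \_ D) P * slope_part P P0 n t) @[t --> 0^'+] -->
      \int[sigma]_(P in D) ((v \_ D) P * kernel P).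
Proof.
have [C [t0 [t00 HC]]] := slope_part_le alpha0 ch bP0 WP0 n1 tangent1 tangent2.
have le t P : 0 < t < t0 -> D P ->
    `|(v \_ D) P * slope_part P P0 n t| <= (c * C) * dist3 P P0 `^ (alpha - 2).
  by move=> tt DP; rewrite normrM -mulrA; apply: ler_pM => //; exact: HC.
have mq t : measurable_fun (D : set R3) (fun P => (v \_ D) P * slope_part P P0 n t : mR).
  apply: measurable_funTS; apply: measurable_funM => //.
  exact: measurable_slope_part.
have lk P : D P -> (v \_ D) P * slope_part P P0 n t @[t --> 0^'+] -->
    (v \_ D) P * kernel P.
  move=> _; apply: cvgM; first exact: cvg_cst.
  have [->|PP0] := eqVneq P P0.
    rewrite /kernel dist3_self expr0n invr0 mulr0.
    rewrite (_ : slope_part _ _ _ = cst 0); first exact: cvg_cst.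
    by apply/funext => t; rewrite /slope_part /quotient_den dist3_self !mul0r invr0 mulr0.
  by apply: cvg_slope_part => //; exact: cvg_at_right_filter cvg_id.
have [ik lim] := dominated_cvg_at_right mD t00 (fun t _ => mq t)
  (measurable_funTS (measurable_funM mv measurable_kernel0))
  (integrable_dist3_powR P0 (c * C) alpha2) lk le.
split => //; exists t0 => //; split => // t tt.
exact: (integrable_le_dist3_powR mD (fun _ => id) alpha2 (mq t) (fun P DP => le t P tt DP)).
Qed.

(** Only the part of the surface near [P0] contributes in the limit, by
    [near_jump_limit]; elsewhere the kernel of the jump tends to [0] boundedly. *)
Let jump_limit :
  exists2 t0 : R, 0 < t0 &
    (forall t, 0 < t < t0 ->
      sigma.-integrable D (fun P => ((v \_ D) P * jump_part P P0 n t)%:E)) /\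
    \int[sigma]_(P in D) ((v \_ D) P * jump_part P P0 n t) @[t --> 0^'+] -->
      2 * pi * v P0.
Proof.
have cvP0 : (v \_ D) P @[P --> within D (nbhs P0)] --> (v \_ D) P0.
  rewrite vD//; have /subspace_continuousP cv' := cv.
  apply: cvg_trans (cv' _ bP0); apply: near_eq_cvg; rewrite near_withinE.
  by apply: nearW => P DP; rewrite vD.
have [r [r0 oU UP0 ij lj]] := near_jump_limit alpha0 sigmaS ch bP0 WP0 n1
  tangent1 tangent2 mv vc cvP0.
set U := W `&` _ in oU UP0.
have [e e0 eU] := ball_neighborhood oU UP0.
have [t0 t00 half] := dist3_shift_ge_half alpha0 ch bP0 WP0 n1 tangent1 tangent2.
pose near_part := surface_patch Omega k W (ball (drop_coord k P0) r).
pose far_part := D `\` U.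
have mN : measurable (near_part : set R3).
  by apply: (measurable_patch ch); exact: ball_open.
have mFar : measurable (far_part : set R3).
  by apply: measurableD => //; exact: open_measurable_R3.
have DE : D = near_part `|` far_part.
  rewrite /near_part /far_part /surface_patch -/U; apply/seteqP; split=> [P DP|P [[]//|[]//]].
  by have [UP|UP] := pselect (U P); [left|right].
have disj : [disjoint near_part & far_part].
  by apply/disj_setPS => P [[_ UP] [_ nUP]].
have splitD (F : R3 -> \bar R) :
    (\int[sigma]_(P in D) F P = \int[sigma]_(P in near_part `|` far_part) F P)%E.
  by rewrite -DE.
pose b := c * (t0 / (e * (e / 2) * e)).
have two2 : 0 < (2 : R) <= 2 by rewrite ltr0n lexx.
have le t P : 0 < t < t0 -> far_part P ->
    `|(v \_ D) P * jump_part P P0 n t| <= b * dist3 P P0 `^ (2 - 2).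
  move=> tt [DP nUP]; rewrite subrr powRr0 mulr1 normrM /b.
  have eP : e <= dist3 P P0 by rewrite leNgt; apply/negP => /eU.
  apply: ler_pM => //; have hd := half _ _ tt DP; case/andP: tt => tt0 tt1.
  have eP2 : e / 2 <= dist3 P (P0 + t *: n).
    by apply: le_trans hd; rewrite ler_pM2r// invr_gt0.
  have e20 : 0 < e / 2 by rewrite divr_gt0.
  have den : e * (e / 2) * e <= quotient_den P P0 n t.
    rewrite /quotient_den; apply: ler_pM; rewrite ?mulr_ge0 ?(ltW e0) ?(ltW e20)//.
      by apply: ler_pM; rewrite ?(ltW e0) ?(ltW e20).
    by apply: (le_trans eP); rewrite lerDl dist3_ge0.
  have den0 : 0 < e * (e / 2) * e by rewrite !mulr_gt0.
  rewrite /jump_part normrM normfV (gtr0_norm tt0) (gtr0_norm (lt_le_trans den0 den)).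
  apply: ler_pM; rewrite ?invr_ge0 ?(ltW tt0) ?(ltW tt1) ?(ltW (lt_le_trans den0 den))//.
  by rewrite lef_pV2 ?posrE// (lt_le_trans den0 den).
have mq t : measurable_fun [set: R3] (fun P => (v \_ D) P * jump_part P P0 n t : mR).
  by apply: measurable_funM => //; exact: measurable_jump_part.
have farD : far_part `<=` D by move=> P [].
have ifar t : 0 < t < t0 ->
    sigma.-integrable far_part (fun P => ((v \_ D) P * jump_part P P0 n t)%:E).
  move=> tt; exact: (integrable_le_dist3_powR mFar farD two2 (measurable_funTS (mq t))
    (fun P FP => le t P tt FP)).
have iD t : 0 < t < t0 ->
    sigma.-integrable D (fun P => ((v \_ D) P * jump_part P P0 n t)%:E).
  move=> tt; have /andP[tt0 _] := tt.
  have mqE : measurable_fun [set: R3] (fun P => ((v \_ D) P * jump_part P P0 n t)%:E).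
    by apply/measurable_EFinP; exact: mq.
  apply/integrableP; split; first exact: measurable_funTS.
  rewrite splitD ge0_integral_setU//.
  - apply: lte_add_pinfty.
      by have /integrableP[] := ij t tt0.
    by have /integrableP[] := ifar t tt.
  - by apply: measurable_funTS; apply: measurableT_comp.
exists t0 => //; split => //.
have far0 : \int[sigma]_(P in far_part) ((v \_ D) P * jump_part P P0 n t)
    @[t --> 0^'+] --> (0 : R).
  have lk P : far_part P -> (v \_ D) P * jump_part P P0 n t @[t --> 0^'+] --> (0 : R).
    move=> [_ nUP]; rewrite -[X in _ --> X](mulr0 ((v \_ D) P)).
    apply: cvgM; first exact: cvg_cst.
    apply: cvg_jump_part; last exact: cvg_at_right_filter cvg_id.
    by apply/eqP => PP0; apply: nUP; rewrite PP0.
  have [_] := dominated_cvg_at_right mFar t00 (fun t _ => measurable_funTS (mq t))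
    (@measurable_cst _ _ R3 mR far_part (0 : R))
    (integrableS mD mFar farD (integrable_dist3_powR P0 b two2)) lk le.
  by rewrite (_ : \int[sigma]_(P in far_part) 0 = 0)// Rintegral_cst// mul0r.
rewrite -[X in _ --> X]addr0 -[v P0]vD//.
apply: cvg_trans (cvgD lj far0); apply: near_eq_cvg; near=> t.
have tt : 0 < t < t0.
  by apply/andP; split; near: t; [exact: nbhs_right_gt|exact: nbhs_right_lt].
rewrite [in RHS]/Rintegral splitD -/(Rintegral _ _ _) Rintegral_setU//.
by rewrite -DE; exact: iD.
Unshelve. all: by end_near. Qed.

(** Applied to [n] this is the exterior derivative; applied to [- n] it is the
    interior one up to sign, which is why the two jumps are opposite. *)
Lemma normal_derivative_potential :
  sigma.-integrable D (fun P => (v P * normal_kernel P P0 n)%:E) /\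
    (u (P0 + t *: n) - u P0) / dist3 (P0 + t *: n) P0 @[t --> 0^'+] -->
      \int[sigma]_(P in D) (v P * normal_kernel P P0 n) - 2 * pi * v P0.
Proof.
have [ik [t1 t10 [is_ ls]]] := slope_limit.
have [t2 t20 [ij lj]] := jump_limit.
have [t3 t30 half] := dist3_shift_ge_half alpha0 ch bP0 WP0 n1 tangent1 tangent2.
have kE P : D P -> P <> P0 -> (v \_ D) P * kernel P = v P * normal_kernel P P0 n.
  by move=> DP /eqP PP0; rewrite vD// normal_kernelE.
have [ivk intE] := integral_off_pole (measurable_funM mv measurable_kernel0)
  (fun P DP PP0 => esym (kE P DP PP0)) ik.
split => //.
rewrite intE; apply: cvg_trans (cvgB ls lj); apply: near_eq_cvg; near=> t.
have tt1 : 0 < t < t1.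
  by apply/andP; split; near: t; [exact: nbhs_right_gt|exact: nbhs_right_lt].
have tt2 : 0 < t < t2.
  by apply/andP; split; near: t; [exact: nbhs_right_gt|exact: nbhs_right_lt].
have tt3 : 0 < t < t3.
  by apply/andP; split; near: t; [exact: nbhs_right_gt|exact: nbhs_right_lt].
have /andP[t0 _] := tt1.
rewrite difference_quotientE//.
transitivity (\int[sigma]_(P in D) ((v \_ D) P * slope_part P P0 n t) -
  \int[sigma]_(P in D) ((v \_ D) P * jump_part P P0 n t)); first by [].
rewrite -(RintegralB mD (is_ _ tt1) (ij _ tt2)).
apply: esym; apply: (proj2 (integral_off_pole _ _ _)).
- by apply: measurable_funB; apply: measurable_funM => //;
    [exact: measurable_slope_part|exact: measurable_jump_part].
- move=> P DP /eqP PP0; rewrite -mulrBr /quot quotient_split ?gt_eqF ?dist3_gt0//.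
  have d0 : 0 < dist3 P P0 / 2 by rewrite divr_gt0// dist3_gt0.
  by rewrite -dist3_gt0; exact: lt_le_trans d0 (half _ _ tt3 DP).
- exact: (integrableB mD (is_ _ tt1) (ij _ tt2)).
Unshelve. all: by end_near. Qed.

Lemma integral_normal_kernelN :
  \int[sigma]_(P in D) (v P * normal_kernel P P0 (- n)) =
  - \int[sigma]_(P in D) (v P * normal_kernel P P0 n).
Proof.
have [ik _] := slope_limit.
have mk := measurable_funM mv measurable_kernel0.
have kE P : D P -> P <> P0 -> v P * normal_kernel P P0 n = (v \_ D) P * kernel P.
  by move=> DP /eqP PP0; rewrite vD// normal_kernelE.
have kNE P : D P -> P <> P0 ->
    v P * normal_kernel P P0 (- n) = - 1 * ((v \_ D) P * kernel P).
  move=> DP /eqP PP0; rewrite vD// normal_kernelE ?enorm3N// /kernel.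
  by rewrite (_ : dot3 _ (- n) = - dot3 (P - P0) n); [ring|rewrite /dot3/=; ring].
rewrite (integral_off_pole mk kE ik).2.
have mNk : measurable_fun [set: R3] (fun P => - 1 * ((v \_ D) P * kernel P) : mR).
  exact: measurable_funM.
have iNk := @integrableZl _ _ _ _ _ mD (- 1) _ ik.
rewrite (integral_off_pole mNk kNE iNk).2.
have := RintegralZl (- 1) mD ik; rewrite mulN1r; exact.
Qed.

End at_boundary_point.

End single_layer.

Unset Implicit Arguments.

Theorem theorem2p3 (R : realType) (alpha : R) (Omega : set (R * R * R))
  (sigma : {measure set (measurableTypeR R * measurableTypeR R *
                         measurableTypeR R) -> \bar R})
  (v : R * R * R -> R) :
  0 < alpha <= 1 ->
  bounded_domain Omega ->
  boundary_C1_holder alpha Omega ->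
  surface_measure alpha Omega sigma ->
  {within boundary Omega, continuous v} ->
  (forall M : R * R * R,
    sigma.-integrable (boundary Omega) (fun P => (v P / dist3 P M)%:E)) /\
  forall P0 n : R * R * R,
    boundary Omega P0 ->
    exterior_unit_normal alpha Omega P0 n ->
    let u := simple_layer Omega sigma v in
    let kernel_integral :=
      \int[sigma]_(P in boundary Omega) (v P * normal_kernel P P0 n) in
    [/\ sigma.-integrable (boundary Omega)
          (fun P => (v P * normal_kernel P P0 n)%:E),
        (u (P0 + t *: n) - u P0) / dist3 (P0 + t *: n) P0 @[t --> 0^'+]
          --> kernel_integral - 2 * pi * v P0 &
        (u P0 - u (P0 - t *: n)) / dist3 P0 (P0 - t *: n) @[t --> 0^'+]
          --> kernel_integral + 2 * pi * v P0].
Proof.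
move=> /andP[alpha0 alpha1] [_ _ _ Omega_bounded] OmegaC sigmaS cv.
split=> [M|P0 n bP0 [[k [V [W [f [ch WP0 t1 t2]]]]] [n1 _]] u kernel_integral].
  exact: (potential_integrable alpha0 Omega_bounded OmegaC sigmaS cv M).
have side := normal_derivative_potential alpha0 alpha1 Omega_bounded OmegaC
  sigmaS cv ch bP0 WP0.
have [ik lim] := side n n1 t1 t2.
have dotN P : dot3 (- n) P = - dot3 n P by rewrite /dot3/=; ring.
have nN1 : enorm3 (- n) = 1 by rewrite enorm3N.
have t1N : dot3 (- n) (put k (1, 0) (partial1 f (drop_coord k P0))) = 0.
  by rewrite dotN t1 oppr0.
have t2N : dot3 (- n) (put k (0, 1) (partial2 f (drop_coord k P0))) = 0.
  by rewrite dotN t2 oppr0.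
have [_ limN] := side (- n) nN1 t1N t2N.
have kN := integral_normal_kernelN alpha0 alpha1 Omega_bounded OmegaC sigmaS cv
  ch bP0 WP0 n1 t1 t2.
split; [exact: ik|exact: lim|].
have -> : kernel_integral + 2 * pi * v P0 = - (- kernel_integral - 2 * pi * v P0).
  by rewrite opprD !opprK.
rewrite -[X in - (X - _)]kN.
apply: cvg_trans (cvgN limN); apply: near_eq_cvg; near=> t.
transitivity (- ((u (P0 + t *: - n) - u P0) / dist3 (P0 + t *: - n) P0)) => //.
by rewrite scalerN (dist3C P0) -mulNr opprB.
Unshelve. all: by end_near. Qed.
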